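(* Let $\mathbf{A}$ be a $0$-$1$ matrix of full row rank with $I$ columns and at least one $1$ in every column, let $RM_{\boldsymbol p}(\mathbf{A})=\{\boldsymbol p\in\mathbb R^I_{>0}:\mathbf1'\boldsymbol p=1,\ \log\boldsymbol p=\mathbf A'\boldsymbol\theta\text{ for some }\boldsymbol\theta\}$, and let $K=\dim(\mathrm{Ker}(\mathbf A))$. Let $\boldsymbol p_0\in RM_{\boldsymbol p}(\mathbf A)$ and $\boldsymbol Y=\boldsymbol Y_N\sim\mathrm{Mult}(N,\boldsymbol p_0)$. Let $\hat{\boldsymbol p}$ be the MLE of $\boldsymbol p_0$ under $RM_{\boldsymbol p}(\mathbf A)$, $\mathscr E$ the set of data values for which it exists, and $\tilde{\boldsymbol p}$ the augmented MLE. Then, as $N\to\infty$, each of $$\mathcal L(X^2(\boldsymbol Y,N\hat{\boldsymbol p})\mid\boldsymbol Y\in\mathscr E),\quad\mathcal L(B(\boldsymbol Y,N\hat{\boldsymbol p})\mid\boldsymbol Y\in\mathscr E),\quad\mathcal L(X^2(\boldsymbol Y,N\tilde{\boldsymbol p})),\quad\mathcal L(B(\boldsymbol Y,N\tilde{\boldsymbol p}))$$ converges to $\chi^2_K$.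
   Context: Vector logs are componentwise. The MLE maximizes $\boldsymbol Y'\log\boldsymbol p$ over the model; $\mathscr E$ is the set of observations for which the maximum is attained in the model. Augmented MLE: $\tilde{\boldsymbol p}=\hat{\boldsymbol p}$ if $\boldsymbol Y\in\mathscr E$ and $(1/I)\mathbf1$ otherwise. For $\boldsymbol u\ge\mathbf0,\boldsymbol v>\mathbf0$: $X^2(\boldsymbol u,\boldsymbol v)=\sum_i(u_i-v_i)^2/v_i$ (Pearson) and $B(\boldsymbol u,\boldsymbol v)=2\sum_i\{u_i\log(u_i/v_i)-(u_i-v_i)\}$ (Bregman), with $0\log0=0$. *)

(* Defs.v *)
From HB Require Import structures.
From mathcomp Require Import all_boot all_order all_algebra.
From mathcomp Require Import all_classical all_reals all_analysis.
Set Implicit Arguments. Unset Strict Implicit. Unset Printing Implicit Defensive.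
Import Order.TTheory GRing.Theory Num.Theory.
Import numFieldNormedType.Exports.
Local Open Scope classical_set_scope.
Local Open Scope ring_scope.

Section Defs.
Variable R : realType.

Definition zero_one_mx (J I : nat) (A : 'M[R]_(J, I)) : Prop :=
  forall j i, A j i = 0 \/ A j i = 1.

Definition col_has_one (J I : nat) (A : 'M[R]_(J, I)) : Prop :=
  forall i, exists j, A j i = 1.

(** K = dim Ker(A), Ker(A) = {x in R^I | A x = 0} = row kernel of A^T. *)
Definition dimKer (J I : nat) (A : 'M[R]_(J, I)) : nat := \rank (kermx A^T).

Definition RM (J I : nat) (A : 'M[R]_(J, I)) (p : 'cV[R]_I) : Prop :=
  (forall i, 0 < p i 0) /\ \sum_i p i 0 = 1 /\
  exists theta : 'cV[R]_J, map_mx (@ln R) p = A^T *m theta.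

Definition loglik (I : nat) (y : 'I_I -> nat) (p : 'cV[R]_I) : R :=
  \sum_i (y i)%:R * ln (p i 0).

Definition is_MLE (J I : nat) (A : 'M[R]_(J, I)) (y : 'I_I -> nat)
    (p : 'cV[R]_I) : Prop :=
  RM A p /\ forall q, RM A q -> loglik y q <= loglik y p.

Definition MLE_exists (J I : nat) (A : 'M[R]_(J, I)) (y : 'I_I -> nat) : Prop :=
  exists p, is_MLE A y p.

Definition aug_MLE (J I : nat) (A : 'M[R]_(J, I))
    (phat : ('I_I -> nat) -> 'cV[R]_I) (y : 'I_I -> nat) : 'cV[R]_I :=
  if `[< MLE_exists A y >] then phat y else const_mx (I%:R^-1).

Definition pearson (I : nat) (u v : 'I_I -> R) : R :=
  \sum_i (u i - v i) ^+ 2 / v i.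

Definition bregman (I : nat) (u v : 'I_I -> R) : R :=
  2 * \sum_i ((if u i == 0 then 0 else u i * ln (u i / v i)) - (u i - v i)).

(** Outcomes of Mult(N, p): count vectors with entries in {0..N}
    (the pmf vanishes unless the counts sum to N). *)
Definition outcome (I N : nat) := {ffun 'I_I -> 'I_N.+1}.

Definition counts (I N : nat) (y : outcome I N) : 'I_I -> nat :=
  fun i => nat_of_ord (y i).

Definition mult_pmf (I N : nat) (p : 'cV[R]_I) (y : outcome I N) : R :=
  if (\sum_i counts y i == N)%N then
    (N`!)%:R / (\prod_i ((counts y i)`!)%:R) * \prod_i p i 0 ^+ counts y i
  else 0.

Definition mult_prob (I N : nat) (p : 'cV[R]_I) (S : ('I_I -> nat) -> Prop) : R :=
  \sum_(y : outcome I N | `[< S (counts y) >]) mult_pmf p y.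

Definition stat_cdf (I N : nat) (p : 'cV[R]_I) (T : ('I_I -> nat) -> R) (x : R) : R :=
  mult_prob N p (fun y => T y <= x).

Definition cond_stat_cdf (I N : nat) (p : 'cV[R]_I) (T : ('I_I -> nat) -> R)
    (E : ('I_I -> nat) -> Prop) (x : R) : R :=
  mult_prob N p (fun y => E y /\ T y <= x) / mult_prob N p E.

(** Chi-square distribution with K degrees of freedom: for K > 0 the
    CDF of the density proportional to t^(K/2-1) e^(-t/2) on [0, oo);
    for K = 0 the point mass at 0. *)
Definition chi2_dens (K : nat) (t : R) : R :=
  powR t (K%:R / 2 - 1) * expR (- (t / 2)).

Definition chi2_cdf (K : nat) (x : R) : R :=
  if K == 0%N then (if 0 <= x then 1 else 0)
  else Rintegral lebesgue_measure `[0, x] (chi2_dens K)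
       / Rintegral lebesgue_measure `[0, +oo[ (chi2_dens K).

Definition cvg_chi2 (F : nat -> R -> R) (K : nat) : Prop :=
  forall x : R, {for x, continuous (chi2_cdf K : R -> R)} ->
    (fun N => F N x) @ \oo --> chi2_cdf K x.

End Defs.

(* Main.v *)
Require Import Defs.
From HB Require Import structures.
From mathcomp Require Import all_boot all_order all_algebra.
From mathcomp Require Import all_classical all_reals all_analysis.
From mathcomp Require Import measurable_realfun ring lra zify.
Set Implicit Arguments. Unset Strict Implicit. Unset Printing Implicit Defensive.
Import Order.TTheory GRing.Theory Num.Theory.
Import numFieldNormedType.Exports.
Local Open Scope classical_set_scope.
Local Open Scope ring_scope.

(** A Lindeberg argument replaces the central limit theorem.  The function
    [exp (- s q)] of a quadratic form [q] of rank K evolves under the heat flow as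
    [(1 + 2 s t)^(- K/2) exp (- s q / (1 + 2 s t))], and the multinomial counts form a
    random walk; comparing one step of the walk with one step of the flow shows that the
    Laplace transform of [y' S y / N] tends to [(1 + 2 s)^(- K/2)], that of the chi-square
    distribution.  Here [y' S y / N] is the squared L^2(p)-length of the projection of
    [(y - N p) / (sqrt N p)] onto the K-dimensional orthogonal complement of the constants
    and of the tangent space of the model.  Laplace transforms at the integers determine the
    limit law, by approximating step functions by polynomials in [exp (- t)].

    It remains to compare both statistics with [y' S y / N] when [|y - N p| <= M sqrt N],
    an event of probability close to 1.  The MLE minimises the Bregman divergence over the
    model, and it exists by compactness once all counts are positive.  Comparison with [p]
    itself gives the rate [sqrt N] for the MLE, so that both divergences become quadratic up
    to [O(1 / sqrt N)]; the projection onto the residual space gives the lower bound, and an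
    explicit member of the model near the projection onto the tangent space the upper one. *)

(** * Multinomial expectations *)

(** The form q = y' S y closes on itself under one draw. A draw of cell i adds 2 b_i + S_ii with b =
    S y; under p, b has mean 0 because S p = 0, its variance is q because S is a projection, and
    S_ii has mean K, the trace. So the second-order effect of a draw on exp(- c q) depends on y
    through q alone and is that of the heat flow. The error per step is of order N^(-3/2), uniformly
    in y, since exp(- c q) absorbs every power of q while c stays away from 0. The constants may lie
    outside the row space of A, so a member of the model cannot be normalised by rescaling. The
    direction A' 1 does this instead: zero-one entries with a 1 in each column put its coordinates
    between 1 and J. Likewise the tangent space consists of the A' tau of p-mean 0; it has
    codimension 1 in the row space because A p <> 0, and adjoining the constants restores that
    dimension, which leaves dim Ker A for the residuals. *)

Section Multinomial.
Variables (R : realType) (I : nat) (p : 'cV[R]_I).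
Implicit Types (f g : ('I_I -> nat) -> R) (y : 'I_I -> nat).

Definition mult_exp N f : R := \sum_(y : outcome I N) mult_pmf p y * f (counts y).

Definition incr i y : 'I_I -> nat := fun j => (y j + (j == i))%N.

Definition mult_step f : ('I_I -> nat) -> R := fun y => \sum_i p i 0 * f (incr i y).

Definition mult_weight y : R := \prod_i (p i 0 ^+ y i / (y i)`!%:R).

Lemma mult_pmfE N (y : outcome I N) : mult_pmf p y =
  if (\sum_i counts y i == N)%N then N`!%:R * mult_weight (counts y) else 0.
Proof.
rewrite /mult_pmf /mult_weight; case: ifP => // _.
by rewrite big_split/= prodfV mulrAC -mulrA.
Qed.

Lemma mult_weight_incr i y :
  mult_weight (incr i y) * (incr i y i)%:R = p i 0 * mult_weight y.
Proof.
rewrite /mult_weight [in LHS](bigD1 i)//= [in RHS](bigD1 i)//=.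
under eq_bigr => j ji do rewrite /incr (negbTE ji) addn0.
rewrite {1 2 3}/incr eqxx addn1 factS natrM exprS.
have y0 : (y i).+1%:R != 0 :> R by rewrite pnatr_eq0.
have y1 : ((y i)`!)%:R != 0 :> R by rewrite pnatr_eq0 -lt0n fact_gt0.
by move: (_.+1%:R) (_`!%:R) y0 y1 => a b a0 b0; field; rewrite a0 b0.
Qed.

Lemma sum_incr i y : (\sum_j incr i y j = (\sum_j y j).+1)%N.
Proof.
rewrite /incr big_split/= -addn1; congr addn; rewrite (bigD1 i)//= eqxx big1 ?addn0// => j.
by move/negbTE ->.
Qed.

(** A draw changes the bound in the type of outcomes. These maps are mutually inverse between
    vectors of total N and vectors of total N+1 with positive entry i, and there [inord] never
    truncates. *)
Let up N i (y : outcome I N) : outcome I N.+1 := [ffun j => inord (incr i (counts y) j)].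
Let down N i (y : outcome I N.+1) : outcome I N := [ffun j => inord (y j - (j == i))].

Let counts_up N i (y : outcome I N) : counts (up i y) = incr i (counts y).
Proof.
apply/funext => j; rewrite /counts /up ffunE inordK// /incr /counts ltnS.
by apply: leq_trans (leq_add (leq_ord (y j)) (leq_b1 _)) _; rewrite addn1.
Qed.

Let upK N i : cancel (@up N i) (@down N i).
Proof.
move=> y; apply/ffunP => j; apply/val_inj; rewrite ffunE/=.
have -> : up i y j = incr i (counts y) j :> nat by rewrite -counts_up.
by rewrite /incr addnK inordK// /counts ltn_ord.
Qed.

Let downK N i (y : outcome I N.+1) : (\sum_j counts y j == N.+1)%N ->
  (0 < counts y i)%N -> up i (down i y) = y.
Proof.
move=> /eqP yN yi; apply/ffunP => j; apply/val_inj.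
rewrite -[LHS]/(counts (up i (down i y)) j) counts_up /incr /counts ffunE.
have yjN : (y j - (j == i) < N.+1)%N.
  have [->|ji] := eqVneq j i; first by rewrite subn1 (prednK yi) leq_ord.
  move: yN; rewrite subn0 (bigD1 j)//= (bigD1 i) 1?eq_sym//= => h.
  by have : (counts y j < N.+1)%N by lia.
rewrite inordK//; have [->|ji] := eqVneq j i; last by rewrite subn0 addn0.
by rewrite subnK.
Qed.

(** Conditioning on the last draw. On vectors of total N+1, (N+1)! = N! * sum_i y_i splits the
    weight over the coordinates; the i-th share is p_i times the weight of the vector with one i
    removed, and it vanishes when y_i = 0. *)
Lemma mult_expS N f : mult_exp N.+1 f = mult_exp N (mult_step f).
Proof.
rewrite /mult_exp /mult_step; under [RHS]eq_bigr do rewrite mulr_sumr.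
rewrite exchange_big/=.
under [LHS]eq_bigr => y _ do rewrite mult_pmfE.
transitivity (\sum_(y : outcome I N.+1 | (\sum_i counts y i == N.+1)%N)
  \sum_i N`!%:R * (mult_weight (counts y) * (counts y i)%:R) * f (counts y)).
  rewrite [RHS]big_mkcond/=; apply: eq_bigr => y _; case: ifP => [/eqP yN|_].
    rewrite -mulr_suml -mulr_sumr -mulr_sumr -natr_sum yN factS natrM.
    by congr (_ * _); ring.
  by rewrite mul0r.
rewrite exchange_big/=; apply: eq_bigr => i _.
rewrite (bigID (fun y : outcome I N.+1 => (0 < counts y i)%N))/= [X in _ + X]big1 ?addr0.
  rewrite (reindex_onto (@up N i) (@down N i)) => [|y /andP[yN yi]]; last exact: downK.
  rewrite big_mkcond/=; apply: eq_bigr => y _.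
  rewrite upK eqxx andbT counts_up sum_incr eqSS mult_pmfE /incr eqxx addn1 andbT.
  rewrite -!/(incr _ _); case: ifP => _; last by rewrite mul0r.
  have := mult_weight_incr i (counts y); rewrite {2}/incr eqxx addn1 => ->.
  ring.
by move=> y /andP[_]; rewrite -leqNgt leqn0 => /eqP ->; rewrite mulr0 mulr0 mul0r.
Qed.

Lemma mult_exp0 f : mult_exp 0 f = f (fun=> 0%N).
Proof.
have c0 (y : outcome I 0) : counts y = fun=> 0%N.
  by apply/funext => i; rewrite /counts (ord1 (y i)).
rewrite /mult_exp (big_pred1 [ffun=> ord0]) => [|y]; last first.
  by apply/esym/eqP/ffunP => i; rewrite ffunE (ord1 (y i)).
rewrite mult_pmfE c0 sum_nat_const muln0 eqxx fact0 mul1r /mult_weight.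
by rewrite big1 ?mul1r// => i _; rewrite expr0 fact0 divr1.
Qed.

Lemma mult_expD N f g : mult_exp N (fun y => f y + g y) = mult_exp N f + mult_exp N g.
Proof. by rewrite /mult_exp -big_split; apply: eq_bigr => y _; rewrite mulrDr. Qed.

Lemma mult_expZ N a f : mult_exp N (fun y => a * f y) = a * mult_exp N f.
Proof. by rewrite /mult_exp mulr_sumr; apply: eq_bigr => y _; rewrite mulrCA. Qed.

Lemma mult_probE N (Q : ('I_I -> nat) -> Prop) :
  mult_prob N p Q = mult_exp N (fun y => (`[< Q y >])%:R).
Proof.
rewrite /mult_prob /mult_exp big_mkcond; apply: eq_bigr => y _.
by case: ifP => _; rewrite ?mulr1 ?mulr0.
Qed.

Hypotheses (p_ge0 : forall i, 0 <= p i 0) (p_sum1 : \sum_i p i 0 = 1).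

Lemma mult_pmf_ge0 N (y : outcome I N) : 0 <= mult_pmf p y.
Proof.
rewrite mult_pmfE; case: ifP => // _; rewrite mulr_ge0//.
by apply: prodr_ge0 => i _; rewrite divr_ge0 ?exprn_ge0.
Qed.

Lemma ler_mult_exp N f g :
  (forall y, (\sum_i y i = N)%N -> f y <= g y) -> mult_exp N f <= mult_exp N g.
Proof.
move=> fg; apply: ler_sum => y _; have := mult_pmf_ge0 y; rewrite mult_pmfE.
by case: ifP => [/eqP/fg h w0|_ _]; [exact: ler_wpM2l|rewrite !mul0r].
Qed.

Lemma mult_exp_cst N a : mult_exp N (fun=> a) = a.
Proof.
elim: N => [|N IH]; first by rewrite mult_exp0.
rewrite mult_expS -{}[RHS]IH; congr mult_exp; apply/funext => y.
by rewrite /mult_step -mulr_suml p_sum1 mul1r.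
Qed.

Lemma mult_exp_dist N f g e :
  (forall y, (\sum_i y i = N)%N -> `|f y - g y| <= e) ->
  `|mult_exp N f - mult_exp N g| <= e.
Proof.
move=> fg; rewrite ler_norml -(mult_exp_cst N (- e)) -{2}(mult_exp_cst N e).
rewrite lerBrDr lerBlDr -!mult_expD; apply/andP; split; apply: ler_mult_exp => y /fg.
  by rewrite ler_norml => /andP[+ _]; rewrite lerBrDr.
by rewrite ler_norml => /andP[_]; rewrite lerBlDr.
Qed.

Lemma mult_prob_le N (P Q : ('I_I -> nat) -> Prop) :
  (forall y, (\sum_i y i = N)%N -> P y -> Q y) -> mult_prob N p P <= mult_prob N p Q.
Proof.
move=> PQ; rewrite !mult_probE; apply: ler_mult_exp => y /PQ {}PQ.
by rewrite ler_nat; case: asboolP => // /PQ Qy; case: asboolP.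
Qed.

Lemma mult_probU N (P Q : ('I_I -> nat) -> Prop) :
  mult_prob N p (fun y => P y \/ Q y) <= mult_prob N p P + mult_prob N p Q.
Proof.
rewrite !mult_probE -mult_expD; apply: ler_mult_exp => y _.
by rewrite -natrD ler_nat; case: asboolP => // -[] ?; case: asboolP => //; case: asboolP.
Qed.

Lemma mult_probC N (P : ('I_I -> nat) -> Prop) :
  mult_prob N p P + mult_prob N p (fun y => ~ P y) = 1.
Proof.
rewrite !mult_probE -mult_expD -[RHS](mult_exp_cst N 1); congr mult_exp.
by apply/funext => y; rewrite asbool_neg; case: asboolP; rewrite ?addr0 ?add0r.
Qed.

Lemma mult_prob_ge0 N (P : ('I_I -> nat) -> Prop) : 0 <= mult_prob N p P.
Proof. by rewrite mult_probE -(mult_exp_cst N 0); apply: ler_mult_exp => y _. Qed.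

(** The shift [a] makes the induction close: one draw turns it into a + 1 - p_i with probability p_i
    and into a - p_i otherwise. *)
Lemma mult_exp_sqr_dev N i (a : R) :
  mult_exp N (fun y => ((y i)%:R - N%:R * p i 0 + a) ^+ 2) =
  N%:R * (p i 0 * (1 - p i 0)) + a ^+ 2.
Proof.
elim: N a => [|N IH] a; first by rewrite mult_exp0 mul0r subr0 mul0r !add0r.
have si : \sum_(j | j != i) p j 0 = 1 - p i 0.
  by apply/eqP; rewrite eq_sym subr_eq -p_sum1 (bigD1 i)//= addrC.
rewrite mult_expS [mult_step _](_ : _ = fun y =>
    p i 0 * ((y i)%:R - N%:R * p i 0 + (a + 1 - p i 0)) ^+ 2 +
    (1 - p i 0) * ((y i)%:R - N%:R * p i 0 + (a - p i 0)) ^+ 2).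
  by rewrite mult_expD !mult_expZ !IH -natr1; ring.
apply/funext => y; rewrite /mult_step (bigD1 i)//= /incr eqxx -si mulr_suml.
have -> : N.+1%:R = N%:R + 1 :> R by rewrite natr1.
congr (_ + _); first by rewrite natrD/=; congr (_ * _ ^+ 2); ring.
apply: eq_bigr => j ji; rewrite eq_sym (negbTE ji) addn0.
by congr (_ * _ ^+ 2); ring.
Qed.

Lemma mult_chebyshev N i (M : R) : (0 < N)%N -> 0 < M ->
  mult_prob N p (fun y => M * Num.sqrt N%:R < `|(y i)%:R - N%:R * p i 0|) <= (M ^+ 2)^-1.
Proof.
move=> N0 M0; have NR : 0 < N%:R :> R by rewrite ltr0n.
have MN : 0 < M ^+ 2 * N%:R by rewrite mulr_gt0// exprn_gt0.
rewrite -(ler_pM2l MN) mult_probE -mult_expZ.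
apply: (@le_trans _ _ (mult_exp N (fun y => ((y i)%:R - N%:R * p i 0 + 0) ^+ 2))).
  apply: ler_mult_exp => y _; rewrite addr0; case: asboolP => [h|_].
    rewrite mulr1 -[leRHS]real_normK ?num_real//.
    rewrite [leLHS](_ : _ = (M * Num.sqrt N%:R) ^+ 2); last first.
      by rewrite exprMn sqr_sqrtr ?ler0n.
    by rewrite ler_sqr ?nnegrE ?(ltW h)// mulr_ge0 ?sqrtr_ge0// ltW.
  by rewrite mulr0 sqr_ge0.
rewrite mult_exp_sqr_dev expr0n/= addr0 [leRHS]mulrAC mulfV ?mul1r; last first.
  by rewrite expf_neq0// gt_eqF.
have p1 : p i 0 <= 1 by rewrite -p_sum1 (bigD1 i)//= lerDl sumr_ge0.
by rewrite ler_piMr ?(ltW NR)//; have := p_ge0 i; nra.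
Qed.

End Multinomial.

(** * Laplace transform of a quadratic form *)

Section ExpBounds.
Variable R : realType.
Implicit Types t x y : R.

(** The tail of the series is |t|^m times a series dominated term by term by that of exp |t|,
    because n! <= (n+m)!. *)
Lemma expR_taylor m t :
  `|expR t - \sum_(k < m) t ^+ k / k`!%:R| <= `|t| ^+ m * expR `|t|.
Proof.
have cv : (fun n => `|series (exp_coeff t) (n + m)%N - \sum_(k < m) t ^+ k / k`!%:R|)
    @ \oo --> `|expR t - \sum_(k < m) t ^+ k / k`!%:R|.
  apply: cvg_norm; apply: cvgB; last exact: cvg_cst.
  rewrite cvg_shiftn; exact: is_cvg_series_exp_coeff.
rewrite -(cvg_lim _ cv)//; apply: limr_le; first by apply/cvg_ex; eexists; exact: cv.
near=> n; rewrite /series/= addnC big_mkord big_split_ord/= addrAC subrr add0r.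
apply: le_trans (ler_norm_sum _ _ _) _.
apply: (@le_trans _ _ (`|t| ^+ m * \sum_(i < n) `|t| ^+ i / i`!%:R)).
  rewrite mulr_sumr; apply: ler_sum => i _; rewrite /exp_coeff/= normrM normrX.
  rewrite normfV (ger0_norm (ler0n _ _)) exprD -mulrA.
  rewrite !ler_wpM2l ?exprn_ge0// lef_pV2 ?posrE ?ltr0n ?fact_gt0// ler_nat.
  by rewrite leq_fact// leq_addl.
rewrite ler_wpM2l ?exprn_ge0//.
have <- : series (exp_coeff `|t|) n = \sum_(i < n) `|t| ^+ i / i`!%:R.
  by rewrite /series/= big_mkord.
apply: nondecreasing_cvgn_le; last exact: is_cvg_series_exp_coeff.
apply/nondecreasing_seqP => k; rewrite /series/= big_nat_recr//= lerDl.
by rewrite /exp_coeff/= divr_ge0// exprn_ge0.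
Unshelve. all: by end_near. Qed.

Lemma expR_taylor2 t : `|expR t - 1 - t| <= t ^+ 2 * expR `|t|.
Proof.
have := expR_taylor 2 t; rewrite !big_ord_recl big_ord0/= addr0 /bump/= expr0 fact0.
by rewrite divr1 expr1 divr1 real_normK ?num_real// opprD addrA.
Qed.

Lemma expR_taylor3 t : `|expR t - 1 - t - t ^+ 2 / 2| <= `|t| ^+ 3 * expR `|t|.
Proof.
have := expR_taylor 3 t; rewrite !big_ord_recl big_ord0/= addr0 /bump/= expr0 fact0.
by rewrite divr1 expr1 divr1 !opprD !addrA.
Qed.

Lemma expn_le_expR n x : 0 <= x -> x ^+ n <= n`!%:R * expR x.
Proof.
move=> x0; case: n => [|n].
  by rewrite expr0 fact0 mul1r (le_trans _ (expR_ge1Dx x))// lerDl.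
have n0 : 0 < n.+1`!%:R :> R by rewrite ltr0n fact_gt0.
rewrite mulrC -ler_pdivrMr// (le_trans _ (expR_ge1Dxn n x0))//.
by rewrite lerDr.
Qed.

(** This is ln z <= z - 1 at z = 1 / (1 + x). *)
Lemma ln1D_ge x : 0 <= x -> x - x ^+ 2 <= ln (1 + x).
Proof.
move=> x0; have x1 : 0 < 1 + x by lra.
have i1 : 0 < (1 + x)^-1 by rewrite invr_gt0.
have : ln (1 + ((1 + x)^-1 - 1)) <= (1 + x)^-1 - 1 by apply: le_ln1Dx; lra.
rewrite [1 + (_ - 1)]addrC subrK lnV ?posrE//.
have -> : (1 + x)^-1 - 1 = - (x / (1 + x)) by field; rewrite gt_eqF.
rewrite lerN2 => h1; apply: le_trans h1; rewrite ler_pdivlMr//; nra.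
Qed.

End ExpBounds.

(** * One step of the walk against one step of the heat flow *)

Section HeatStep.
Variables (R : realType) (I : nat) (p : 'I_I -> R).
Hypotheses (p_gt0 : forall i, 0 < p i) (p_sum1 : \sum_i p i = 1).

Lemma norm_mean (f : 'I_I -> R) B : (forall i, `|f i| <= B) -> `|\sum_i p i * f i| <= B.
Proof.
move=> fB; rewrite (le_trans (ler_norm_sum _ _ _))//.
rewrite -[leRHS]mul1r -p_sum1 mulr_suml; apply: ler_sum => i _.
by rewrite normrM (gtr0_norm (p_gt0 i)) ler_pM2l.
Qed.

(** There are finitely many cells, all of positive weight, so 1 / sqrt p_i times the L^2(p)-norm
    bounds coordinate i. For the linear part of an increment of q this norm is sqrt q. *)
Lemma ex_weight_bound : exists2 L, 0 <= L & forall (b : 'I_I -> R) i,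
  `|b i| <= L * Num.sqrt (\sum_j p j * b j ^+ 2).
Proof.
exists (\sum_i (Num.sqrt (p i))^-1) => [|b i].
  by apply: sumr_ge0 => i _; rewrite invr_ge0 sqrtr_ge0.
have sp : 0 < Num.sqrt (p i) by rewrite sqrtr_gt0.
apply: (@le_trans _ _ ((Num.sqrt (p i))^-1 * Num.sqrt (\sum_j p j * b j ^+ 2))).
  rewrite mulrC ler_pdivlMr// -sqrtr_sqr -sqrtrM ?sqr_ge0// ler_wsqrtr//.
  rewrite (bigD1 i)//= mulrC lerDl sumr_ge0// => j _.
  by rewrite mulr_ge0 ?sqr_ge0// ltW.
rewrite ler_wpM2r ?sqrtr_ge0// (bigD1 i)//= lerDl.
by apply: sumr_ge0 => j _; rewrite invr_ge0 sqrtr_ge0.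
Qed.

(** With d = 2 c e^2 and z = c v the flow step has exponent - z + t, where t is d (z - k) up to d^2
    (k + z). The remainders grow with z, but exp(- z) absorbs them, so the bound is free of v. *)
Lemma heat_step_exact (k : R) : 0 <= k -> forall c e v : R, 0 < c -> 0 <= v -> 0 < e ->
  2 * c * e ^+ 2 <= 1 / 2 ->
  `|expR (- k * ln (1 + 2 * c * e ^+ 2) - c / (1 + 2 * c * e ^+ 2) * v)
    - expR (- (c * v)) * (1 - c * (2 * k) * e ^+ 2 + 2 * c ^+ 2 * e ^+ 2 * v)|
  <= (2 * c * e ^+ 2) ^+ 2 * (9 * expR (4 * k)).
Proof.
move=> k0 c e v c0 v0 e0; set d := 2 * c * e ^+ 2 => dh.
have d0 : 0 < d by rewrite /d !mulr_gt0// exprn_gt0.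
have d2 : 0 < 1 + d by lra.
have d1 : 1 + d != 0 by rewrite gt_eqF.
pose z := c * v; have z0 : 0 <= z by rewrite mulr_ge0// ltW.
pose t := - k * ln (1 + d) + z * d / (1 + d).
have -> : - k * ln (1 + d) - c / (1 + d) * v = - z + t by rewrite /t /z; field.
have -> : 1 - c * (2 * k) * e ^+ 2 + 2 * c ^+ 2 * e ^+ 2 * v = 1 + d * (z - k).
  by rewrite /d /z; ring.
rewrite expRD -mulrBr normrM (gtr0_norm (expR_gt0 _)).
have l1 : ln (1 + d) <= d by apply: le_ln1Dx; lra.
have l2 := ln1D_ge (ltW d0).
have zd : z * d / (1 + d) = z * d - z * d ^+ 2 / (1 + d) by field.
have zd2 : 0 <= z * d ^+ 2 / (1 + d) <= z * d ^+ 2.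
  have z2 : 0 <= z * d ^+ 2 by rewrite mulr_ge0// sqr_ge0.
  rewrite divr_ge0 ?(ltW d2)//= ler_pdivrMr//.
  by rewrite ler_peMr// lerDl ltW.
have ht : `|t - d * (z - k)| <= d ^+ 2 * (k + z).
  rewrite /t zd; move: zd2; set w := z * d ^+ 2 / (1 + d) => /andP[w0 w1].
  by rewrite ler_norml; apply/andP; split; nra.
have ta : `|t| <= d * (k + z).
  rewrite /t ler_norml; have [w0 w1] : 0 <= z * d / (1 + d) /\ z * d / (1 + d) <= z * d.
    have z1 : 0 <= z * d by rewrite mulr_ge0// ltW.
    rewrite divr_ge0 ?(ltW d2)//= ler_pdivrMr//.
    by rewrite ler_peMr// lerDl ltW.
  have l0 : 0 <= ln (1 + d) by apply: ln_ge0; lra.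
  by apply/andP; split; nra.
have e2 := expR_taylor2 t.
have T2 : t ^+ 2 <= d ^+ 2 * (k + z) ^+ 2.
  by rewrite -exprMn -[leLHS]real_normK ?num_real// ler_sqr ?nnegrE ?mulr_ge0 ?addr_ge0// ltW.
(* As d <= 1/2, half of z remains in this exponent and [kz] brings the other half, so exp(- z)
   cancels both. The final 9 adds the 1 from the error in t to the 8 of [kz]. *)
have E1 : expR `|t| <= expR (k + z / 2).
  by rewrite ler_expR (le_trans ta)//; nra.
have kz : (k + z) ^+ 2 <= 8 * expR ((k + z) / 2).
  have kz2 : 0 <= (k + z) / 2 by rewrite divr_ge0 ?addr_ge0.
  by have := expn_le_expR 2 kz2; rewrite expr_div_n !factS fact0; nra.
have main : `|expR t - (1 + d * (z - k))| <=
    d ^+ 2 * (expR (k + z) + 8 * expR ((k + z) / 2) * expR (k + z / 2)).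
  have -> : expR t - (1 + d * (z - k)) = (t - d * (z - k)) + (expR t - 1 - t) by ring.
  rewrite (le_trans (ler_normD _ _))// [leRHS]mulrDr lerD//.
    rewrite (le_trans ht)// ler_wpM2l ?sqr_ge0//.
    by rewrite (le_trans _ (expR_ge1Dx _))// lerDr.
  rewrite (le_trans e2)// (le_trans (ler_pM (sqr_ge0 _) (expR_ge0 _) T2 E1))//.
  by rewrite -[leLHS]mulrA ler_wpM2l ?sqr_ge0// ler_wpM2r// expR_ge0.
rewrite (le_trans (ler_wpM2l (expR_ge0 _) main))// mulrCA ler_wpM2l ?sqr_ge0//.
have -> : 9 * expR (4 * k) = expR (4 * k) + 8 * expR (4 * k) by ring.
rewrite mulrDr lerD//; first by rewrite -expRD ler_expR; lra.
by rewrite mulrCA -mulrA ler_wpM2l// -!expRD ler_expR; lra.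
Qed.

(** Expanding the walk to second order, the mean of b kills the term in e, and the variance of b and
    the mean of d give the two terms in e^2 of [heat_step_exact]. The cubic remainder carries a
    factor exponential in sqrt v; exp(- c v) dominates it uniformly because c >= c0 > 0. *)
Lemma heat_step (k s c0 D : R) : 0 <= k -> 0 < c0 -> 0 <= D -> exists2 C : R, 0 <= C &
  forall (c e v : R) (b d : 'I_I -> R), c0 <= c <= s -> 0 < e <= 1 ->
    2 * c * e ^+ 2 <= 1 / 2 -> (forall i, `|d i| <= D) ->
    \sum_i p i * b i = 0 -> \sum_i p i * b i ^+ 2 = v -> \sum_i p i * d i = 2 * k ->
  `|\sum_i p i * expR (- c * (v + 2 * e * b i + e ^+ 2 * d i))
    - expR (- k * ln (1 + 2 * c * e ^+ 2) - c / (1 + 2 * c * e ^+ 2) * v)| <= C * e ^+ 3.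
Proof.
move=> k0 c00 D0; have [L L0 Lb] := ex_weight_bound.
(* The exponent changes by at most e a (1 + r), r = sqrt v. In [C1], 12 = 2 * 3! covers two cubic
   remainders through (1+r)^3 <= 3! exp(1+r), and (a+1)^2 / (4 c0) is the maximum over r of (a+1) r
   - c0 r^2. *)
pose a := s * (2 * L + D) + 1.
pose C1 := 12 * a ^+ 3 * expR ((a + 1) + (a + 1) ^+ 2 / (4 * c0)).
pose C2 := 4 * s ^+ 2 * (9 * expR (4 * k)).
exists (`|C1| + C2).
  by apply: addr_ge0 => //; apply: mulr_ge0; apply: mulr_ge0; rewrite ?sqr_ge0 ?expR_ge0.
move=> c e v b d /andP[c0c cs] /andP[e0 e1] ce dD sb sb2 sd.
have c_gt0 : 0 < c by lra.
have s0 : 0 < s by lra.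
have s_ge0 := ltW s0; have e_ge0 := ltW e0; have c_ge0 := ltW c_gt0.
have a1 : 1 <= a by rewrite /a lerDr mulr_ge0 ?addr_ge0 ?mulr_ge0.
have v0 : 0 <= v by rewrite -sb2 sumr_ge0// => i _; rewrite mulr_ge0 ?sqr_ge0// ltW.
pose r := Num.sqrt v; have r0 : 0 <= r by exact: sqrtr_ge0.
have vr : v = r ^+ 2 by rewrite sqr_sqrtr.
have r1 : 0 <= 1 + r by lra.
have ar1 : 0 <= a * (1 + r) by rewrite mulr_ge0//; lra.
have br i : `|b i| <= L * r by rewrite (le_trans (Lb b i))// sb2.
have Q := heat_step_exact k0 c_gt0 v0 e0 ce.
move: Q; set W := expR (- k * _ - _); set Q := expR (- (c * v)) * _ => QW.
pose t i := - c * (2 * e * b i + e ^+ 2 * d i).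
have tb i : `|t i| <= e * (a * (1 + r)).
  rewrite /t normrM normrN (gtr0_norm c_gt0).
  apply: (@le_trans _ _ (s * (2 * e * (L * r) + e * D))).
    apply: ler_pM => //.
    rewrite (le_trans (ler_normD _ _))// lerD//.
      by rewrite normrM (@gtr0_norm _ (2 * e)) ?mulr_gt0// ler_wpM2l// mulr_ge0.
    by rewrite normrM normrX (gtr0_norm e0) ler_pM ?exprn_ge0// expr2 ger_pMr.
  have -> : s * (2 * e * (L * r) + e * D) = e * (s * (2 * L * r + D)) by ring.
  rewrite ler_pM2l// /a; have := mulr_ge0 (ltW s0) L0; have := mulr_ge0 (ltW s0) D0; nra.
have rt : `|\sum_i p i * (expR (t i) - 1 - t i - t i ^+ 2 / 2)| <=
    e ^+ 3 * (a ^+ 3 * (1 + r) ^+ 3 * expR (a * (1 + r))).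
  apply: norm_mean => i; rewrite (le_trans (expR_taylor3 _))//.
  rewrite mulrA -exprMn -exprMn; apply: ler_pM; rewrite ?exprn_ge0 ?expR_ge0//.
    by rewrite lerXn2r ?nnegrE ?(mulr_ge0 e_ge0 ar1).
  by rewrite ler_expR (le_trans (tb i))// ler_piMl.
have sq : \sum_i p i * (1 + t i + t i ^+ 2 / 2) =
    \sum_i p i - c * (2 * k) * e ^+ 2 + 2 * c ^+ 2 * e ^+ 2 * v +
    e ^+ 3 * \sum_i p i * (c ^+ 2 * (2 * b i * d i + e * d i ^+ 2 / 2)).
  rewrite -sd -sb2 !mulr_sumr.
  transitivity (\sum_i p i * (1 + t i + t i ^+ 2 / 2) + 2 * c * e * \sum_i p i * b i).
    by rewrite sb mulr0 addr0.
  rewrite !mulr_sumr !mulr_suml -!sumrN -!big_split/=; apply: eq_bigr => i _.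
  by rewrite /t; field.
have sq2 : `|\sum_i p i * (c ^+ 2 * (2 * b i * d i + e * d i ^+ 2 / 2))| <= a ^+ 3 * (1 + r) ^+ 3.
  apply: norm_mean => i; rewrite normrM (ger0_norm (sqr_ge0 _)).
  apply: (@le_trans _ _ (s ^+ 2 * (2 * (L * r) * D + D ^+ 2 / 2))).
    apply: ler_pM; rewrite ?sqr_ge0 ?normr_ge0//; first by rewrite ler_sqr ?nnegrE.
    rewrite (le_trans (ler_normD _ _))// lerD//.
      rewrite normrM ler_pM// normrM (ger0_norm (ler0n _ _)) ler_wpM2l//.
    have dD2 : d i ^+ 2 <= D ^+ 2.
      by rewrite -[leLHS]real_normK ?num_real// ler_sqr ?nnegrE.
    rewrite ger0_norm; last by rewrite divr_ge0// mulr_ge0// sqr_ge0.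
    by have := ler_piMl (sqr_ge0 (d i)) e1; lra.
  have ar : 1 <= a * (1 + r) by nra.
  rewrite -exprMn; apply: (@le_trans _ _ ((a * (1 + r)) ^+ 2)); last first.
    by rewrite [leRHS]exprSr ler_peMr ?sqr_ge0.
  have := mulr_ge0 (ltW s0) L0; have := mulr_ge0 (ltW s0) D0 => sD sL.
  apply: (@le_trans _ _ ((s * (2 * L + D) * (1 + r)) ^+ 2)).
    rewrite -[in leRHS]mulrA exprMn ler_wpM2l ?sqr_ge0//.
    have := mulr_ge0 L0 r0; have := mulr_ge0 L0 D0; have := mulr_ge0 (mulr_ge0 L0 r0) D0.
    have := mulr_ge0 D0 r0 => ? ? ? ?; nra.
  have sa : 0 <= s * (2 * L + D) * (1 + r) by rewrite mulr_ge0// mulr_ge0// addr_ge0// mulr_ge0.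
  by rewrite ler_sqr ?nnegrE// ler_wpM2r// /a lerDl.
have e3 : 0 <= e ^+ 3 by rewrite exprn_ge0.
have P1 : `|\sum_i p i * expR (- c * (v + 2 * e * b i + e ^+ 2 * d i)) - Q| <= `|C1| * e ^+ 3.
  have -> : \sum_i p i * expR (- c * (v + 2 * e * b i + e ^+ 2 * d i)) =
      expR (- (c * v)) * (\sum_i p i * (1 + t i + t i ^+ 2 / 2) +
        \sum_i p i * (expR (t i) - 1 - t i - t i ^+ 2 / 2)).
    rewrite -big_split/= mulr_sumr; apply: eq_bigr => i _.
    rewrite [X in _ = _ * X](_ : _ = p i * expR (t i)); last by ring.
    by rewrite mulrCA -expRD; congr (_ * expR _); rewrite /t; ring.
  rewrite sq p_sum1 /Q -mulrBr normrM (gtr0_norm (expR_gt0 _)).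
  set X := \sum_i _ in sq2 *; set Y := \sum_i _ in rt *.
  rewrite [X in `|X|](_ : _ = e ^+ 3 * X + Y); last by ring.
  apply: (@le_trans _ _ (expR (- (c * v)) *
    (e ^+ 3 * (2 * (a ^+ 3 * (1 + r) ^+ 3 * expR (a * (1 + r))))))).
    rewrite ler_wpM2l ?expR_ge0// (le_trans (ler_normD _ _))//.
    have -> : forall u, e ^+ 3 * (2 * u) = e ^+ 3 * u + e ^+ 3 * u by move=> u; ring.
    rewrite lerD// normrM (ger0_norm e3) ler_wpM2l// (le_trans sq2)//.
    rewrite ler_peMr//; first by rewrite -exprMn exprn_ge0.
    by rewrite (le_trans _ (expR_ge1Dx _))// lerDl.
  rewrite mulrCA [leRHS]mulrC ler_wpM2l// (le_trans _ (ler_norm _))//.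
  have := expn_le_expR 3 r1; rewrite !factS fact0 => r3.
  have a3 : 0 <= a ^+ 3 by rewrite exprn_ge0//; lra.
  apply: (@le_trans _ _ (12 * a ^+ 3 * (expR (- (c * v)) * expR (1 + r) * expR (a * (1 + r))))).
    have := ler_wpM2l a3 r3; have := expR_gt0 (- (c * v)); have := expR_gt0 (a * (1 + r)).
    rewrite [(3 * _)%N]/=; move: (expR _) (expR _) (expR _) => x3 x2 x1 x10 x20 h.
    have -> : x2 * (2 * (a ^+ 3 * (1 + r) ^+ 3 * x1)) =
       2 * x1 * x2 * (a ^+ 3 * (1 + r) ^+ 3) by ring.
    have -> : 12 * a ^+ 3 * (x2 * x3 * x1) = 2 * x1 * x2 * (a ^+ 3 * (6 * x3)) by ring.
    by rewrite ler_wpM2l// !mulr_ge0// ltW.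
  have a12 : 0 <= 12 * a ^+ 3 by apply: mulr_ge0.
  rewrite /C1 ler_wpM2l// -!expRD ler_expR.
  have : 0 <= (2 * c0 * r - (a + 1)) ^+ 2 / (4 * c0) by rewrite divr_ge0 ?sqr_ge0// mulr_ge0// ltW.
  have -> : (2 * c0 * r - (a + 1)) ^+ 2 / (4 * c0) =
     c0 * r ^+ 2 - (a + 1) * r + (a + 1) ^+ 2 / (4 * c0) by field; rewrite gt_eqF.
  rewrite vr; have : c0 * r ^+ 2 <= c * r ^+ 2 by rewrite ler_wpM2r ?sqr_ge0.
  lra.
have P2 : `|Q - W| <= C2 * e ^+ 3.
  have k9 : 0 <= 9 * expR (4 * k) by apply: mulr_ge0 => //; exact: expR_ge0.
  rewrite distrC (le_trans QW)// /C2 [leRHS]mulrAC ler_wpM2r//.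
  have -> : (2 * c * e ^+ 2) ^+ 2 = 4 * c ^+ 2 * (e ^+ 3 * e) by ring.
  apply: ler_pM; [|exact: mulr_ge0| |by rewrite ler_piMr].
    by apply: mulr_ge0 => //; exact: sqr_ge0.
  by rewrite ler_wpM2l// ler_sqr ?nnegrE.
by rewrite -(subrKA Q) (le_trans (ler_normD _ _))// [leRHS]mulrDl lerD.
Qed.

End HeatStep.

(** * Telescoping over the N steps *)

Section Lindeberg.
Variables (R : realType) (I : nat) (p : 'cV[R]_I) (k : R).
Variables (q : ('I_I -> nat) -> R) (b : 'I_I -> ('I_I -> nat) -> R) (d : 'I_I -> R).
Hypotheses (p_gt0 : forall i, 0 < p i 0) (p_sum1 : \sum_i p i 0 = 1) (k_ge0 : 0 <= k).
Hypothesis q0 : q (fun=> 0%N) = 0.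
Hypothesis q_incr : forall i y, q (incr i y) = q y + 2 * b i y + d i.
Hypothesis mean_b : forall y, \sum_i p i 0 * b i y = 0.
Hypothesis var_b : forall y, \sum_i p i 0 * b i y ^+ 2 = q y.
Hypothesis mean_d : \sum_i p i 0 * d i = 2 * k.

(** [H j] is the flow after j of its N steps: [H 0] is the function whose mean is sought, and [H N]
    at the empty count is the limit. Trading one walk step for one flow step costs C e^3 with e = 1
    / sqrt N, hence C / sqrt N in all. The rate s / m_j stays in [s / (1 + 2 s), s], and 4 s <= N
    gives the smallness condition of [heat_step]. *)
Lemma laplace_dist (s : R) : 0 < s -> exists C, forall N : nat, 4 * s <= N%:R ->
  `|mult_exp p N (fun y => expR (- s * (q y / N%:R))) - (1 + 2 * s) `^ (- k)|
  <= C / Num.sqrt N%:R.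
Proof.
move=> s0; have s1 : 0 < 1 + 2 * s by lra.
have c00 : 0 < s / (1 + 2 * s) by rewrite divr_gt0.
have [D D0 dD] : exists2 D, 0 <= D & forall i, `|d i| <= D.
  exists (\sum_i `|d i|); first by rewrite sumr_ge0.
  by move=> i; rewrite (bigD1 i)//= lerDl sumr_ge0.
have [C C0 hC] := heat_step p_gt0 p_sum1 s k_ge0 c00 D0.
exists C => N sN.
have NR : 0 < N%:R :> R by lra.
have N0 : N%:R != 0 :> R by rewrite gt_eqF.
pose e := (Num.sqrt N%:R)^-1 : R.
have e2 : e ^+ 2 = N%:R^-1 by rewrite exprVn sqr_sqrtr ?ltW.
have e0 : 0 < e by rewrite invr_gt0 sqrtr_gt0.
have N1 : 1 <= N%:R :> R by rewrite ler1n -(ltr0n R).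
have e1 : e <= 1 by rewrite invf_le1 ?sqrtr_gt0// -[leLHS]sqrtr1 ler_wsqrtr.
pose m j : R := 1 + 2 * s * j%:R / N%:R.
have m_ge1 j : 1 <= m j by rewrite lerDl divr_ge0 ?ler0n// !mulr_ge0// ltW.
have m_gt0 j : 0 < m j by rewrite (lt_le_trans _ (m_ge1 j)).
pose H j y : R := expR (- k * ln (m j) - s / m j * (q y / N%:R)).
have stepH j y : (j < N)%N -> `|mult_step p (H j) y - H j.+1 y| <= C * e ^+ 3.
  move=> jN; pose c := s / m j.
  have cs : s / (1 + 2 * s) <= c <= s.
    rewrite /c ler_pM2l// lef_pV2 ?posrE// ler_pdivrMr//.
    apply/andP; split; last by rewrite ler_peMr ?(ltW s0).
    rewrite lerD2l ler_pdivrMr// ler_pM2l ?mulr_gt0// ler_nat; exact: ltnW.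
  have cp : 0 < c by rewrite divr_gt0.
  have ce : 2 * c * e ^+ 2 <= 1 / 2.
    by rewrite e2 ler_pdivrMr//; move/andP: cs => [_ ?]; lra.
  have v1 : \sum_i p i 0 * (b i y * e) ^+ 2 = q y / N%:R.
    under eq_bigr do rewrite exprMn e2 mulrA.
    by rewrite -mulr_suml var_b.
  have v2 : \sum_i p i 0 * (b i y * e) = 0.
    by under eq_bigr do rewrite mulrA; rewrite -mulr_suml mean_b mul0r.
  have e01 : 0 < e <= 1 by rewrite e0.
  have := hC c e (q y / N%:R) (fun i => b i y * e) d cs e01 ce dD v2 v1 mean_d.
  set X := \sum_i _; set Y := expR _ => XY.
  (* The semigroup law of the flow: a step takes the rate c to c / (1 + 2 c e^2). *)
  have mj1 : m j.+1 = m j * (1 + 2 * c * e ^+ 2).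
    have mj0 : m j != 0 by rewrite gt_eqF.
    have -> : m j * (1 + 2 * c * e ^+ 2) = m j + 2 * s / N%:R.
      by rewrite e2 /c; move: (m j) mj0 => mj mj0; field; rewrite N0 mj0.
    by rewrite /m -natr1; field.
  have ce1 : 0 < 1 + 2 * c * e ^+ 2.
    by rewrite addr_gt0//; apply: mulr_gt0; [exact: mulr_gt0|exact: exprn_gt0].
  have -> : mult_step p (H j) y = expR (- k * ln (m j)) * X.
    rewrite /mult_step /X mulr_sumr; apply: eq_bigr => i _.
    rewrite mulrCA -expRD; congr (_ * expR _); rewrite q_incr.
    have -> : 2 * e * (b i y * e) = 2 * b i y * e ^+ 2 by ring.
    by rewrite e2 /c; field; rewrite N0 gt_eqF//.
  have -> : H j.+1 y = expR (- k * ln (m j)) * Y.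
    rewrite -expRD /H; congr expR.
    by rewrite mj1 lnM ?posrE// invfM [s * _]mulrA mulrDr addrA.
  rewrite -mulrBr normrM (gtr0_norm (expR_gt0 _)) (le_trans _ XY)//.
  rewrite ler_piMl// expR_le1 mulNr oppr_le0 mulr_ge0// ln_ge0//.
have telescope n j : (n + j)%N = N ->
    `|mult_exp p n (H j) - H N (fun=> 0%N)| <= n%:R * (C * e ^+ 3).
  elim: n j => [|n IH] j njN.
    by rewrite mult_exp0 -njN add0n subrr normr0 mul0r.
  rewrite mult_expS -(subrKA (mult_exp p n (H j.+1))) (le_trans (ler_normD _ _))//.
  rewrite -natr1 mulrDl mul1r addrC lerD//; first by apply: IH; rewrite addnS -addSn.
  apply: mult_exp_dist => // [i|y _]; first exact: ltW.
  by apply: stepH; rewrite -njN addSn ltnS leq_addl.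
have := telescope N 0%N (addn0 N).
have -> : H 0%N = fun y => expR (- s * (q y / N%:R)).
  by apply/funext => y; rewrite /H /m mulr0 mul0r addr0 ln1 mulr0 divr1 sub0r mulNr.
have -> : H N (fun=> 0%N) = (1 + 2 * s) `^ (- k).
  rewrite /H q0 mul0r mulr0 subr0 /powR gt_eqF//; congr (expR (_ * ln _)).
  by rewrite /m mulfK.
move=> h; apply: (le_trans h); rewrite exprS e2 -/e.
by rewrite le_eqVlt; apply/orP; left; apply/eqP; field.
Qed.

Lemma laplace_cvg (s : R) : 0 < s ->
  mult_exp p N (fun y => expR (- s * (q y / N%:R))) @[N --> \oo] --> (1 + 2 * s) `^ (- k).
Proof.
move=> s0; have [C hC] := laplace_dist s0.
apply/cvgrPdist_le => /= eps eps0; near=> N.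
have NR : 4 * s <= N%:R by near: N; exact: nbhs_infty_ger.
have N0 : 0 < N%:R :> R by lra.
rewrite distrC (le_trans (hC N NR))// ler_pdivrMr ?sqrtr_gt0//.
have : (C / eps) ^+ 2 <= N%:R by near: N; exact: nbhs_infty_ger.
move/(ler_wsqrtr); rewrite sqrtr_sqr => h.
have := le_trans (ler_norm _) h; rewrite ler_pdivrMr// mulrC//.
Unshelve. all: by end_near. Qed.

End Lindeberg.

(** * The chi-square distribution *)

Section ChiSquare.
Variable R : realType.
Local Notation mu := (@lebesgue_measure R).

(** Lebesgue measure is a times its image under x -> a x; by uniqueness it is enough to check this
    on half-open intervals. *)
Lemma ge0_integral_scale (a : R) (f : R -> \bar R) : 0 < a ->
  measurable_fun [set: R] f -> (forall x, (0 <= f x)%E) ->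
  (\int[mu]_(x in `[0%R, +oo[) f x = a%:E * \int[mu]_(x in `[0%R, +oo[) f (a * x)%R)%E.
Proof.
move=> a0 mf f0.
pose phi : measurableTypeR R -> measurableTypeR R := fun x => a * x.
have mphi : measurable_fun setT phi by exact: mulrl_measurable.
have [pm pmE] : exists pm : {measure set (measurableTypeR R) -> \bar R},
    forall A, pm A = pushforward mu phi A.
  by unshelve eexists (pushforward mu phi).
pose nu := mscale (NngNum (ltW a0)) pm.
have nuE (A : set (measurableTypeR R)) : measurable A -> mu A = nu A.
  move=> mA; apply: lebesgue_measure_unique => // _ [[x y]] _ <-.
  rewrite [RHS](_ : _ = a%:E * pm `]x, y]%classic)%E// pmE /pushforward.
  have -> : phi @^-1` `]x, y] = `](x / a), (y / a)]%classic.
    apply/seteqP; split => t /=; rewrite !in_itv/= /phi ltr_pdivrMr// ler_pdivlMr//;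
    by rewrite mulrC.
  rewrite !lebesgue_measure_itv/= !lte_fin ltr_pM2r ?invr_gt0//.
  case: ifP => _; last by rewrite mule0.
  by rewrite -!EFinB -EFinM -mulrBl mulrC divfK// gt_eqF.
rewrite (eq_measure_integral nu) => [|A mA _]; last exact: nuE.
rewrite ge0_integral_mscale//; last exact: measurable_funTS.
congr (_ * _)%E; rewrite (eq_measure_integral (pushforward mu phi)) => [|A mA _]; last exact: pmE.
rewrite ge0_integral_pushforward//; last exact: measurable_funTS.
congr (integral _ _ _); apply/seteqP; split => t /=; rewrite !in_itv/= !andbT /phi.
  by rewrite pmulr_rge0.
by move=> t0; rewrite pmulr_rge0.
Qed.

Variable K : nat.
Local Notation dens := (@chi2_dens R K).
Local Notation k := (K%:R / 2 : R).

Lemma chi2_dens_ge0 x : 0 <= dens x.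
Proof. by rewrite mulr_ge0 ?powR_ge0 ?expR_ge0. Qed.

Lemma measurable_chi2_dens : measurable_fun [set: R] dens.
Proof.
apply: measurable_funM; first exact: measurable_powR.
apply: measurableT_comp => //; apply: measurableT_comp => //.
exact: measurable_funM.
Qed.

Lemma measurable_chi2_densE (D : set R) :
  measurable D -> measurable_fun D (fun x => (dens x)%:E).
Proof.
by move=> mD; apply/measurable_EFinP; apply: measurable_funTS; exact: measurable_chi2_dens.
Qed.

Lemma continuous_inv_sqrt_bound (a : R) : 0 < a ->
  {within `[a, +oo[, continuous (fun x : R => (Num.sqrt x)^-1 / (1 + Num.sqrt x) ^+ 2)}.
Proof.
move=> a0; apply: continuous_in_subspaceT => x; rewrite inE/= in_itv/= andbT => ax.
have x0 : 0 < x by exact: lt_le_trans ax.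
have sx : 0 < Num.sqrt x by rewrite sqrtr_gt0.
apply: cvgM.
  by apply: cvgV; [rewrite gt_eqF|exact: sqrt_continuous].
apply: cvgV; first by rewrite expf_neq0// gt_eqF// addr_gt0.
have h : 1 + Num.sqrt y @[y --> x] --> 1 + Num.sqrt x.
  by apply: cvgD; [exact: cvg_cst|exact: sqrt_continuous].
by rewrite expr2; exact: (cvgM h h).
Qed.

(** The integrand has the primitive - 2 / (1 + sqrt x), so the bound does not depend on a. Near 0 it
    behaves as x^(-1/2), the worst singularity of a chi-square density, reached for K = 1. *)
Lemma integral_inv_sqrt_bound (a : R) : 0 < a ->
  (\int[mu]_(x in `[a, +oo[) ((Num.sqrt x)^-1 / (1 + Num.sqrt x) ^+ 2)%:E <= 2%:E)%E.
Proof.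
move=> a0.
pose F (x : R) := - 2 * (1 + Num.sqrt x)^-1.
have dF (x : R) : 0 < x -> is_derive x (1 : R) F ((Num.sqrt x)^-1 / (1 + Num.sqrt x) ^+ 2).
  move=> x0; have sx : 0 < Num.sqrt x by rewrite sqrtr_gt0.
  have s1 : 1 + Num.sqrt x != 0 by rewrite gt_eqF// addr_gt0.
  have := is_derive1_sqrt x0 => ds.
  have d1 : is_derive x (1 : R) (fun y => 1 + Num.sqrt y) (2 * Num.sqrt x)^-1.
    by rewrite -[X in is_derive _ _ _ X]add0r; apply: is_deriveD.
  have d2 := @is_deriveV _ (fun y => 1 + Num.sqrt y) _ _ _ s1 d1.
  have <- : - 2 *: (- (1 + Num.sqrt x) ^- 2 *: (2 * Num.sqrt x)^-1) =
      (Num.sqrt x)^-1 / (1 + Num.sqrt x) ^+ 2 :> R.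
    by rewrite /GRing.scale/=; field; rewrite s1 gt_eqF.
  exact: (is_deriveZ (- 2) d2).
rewrite (@ge0_continuous_FTC2y _ _ F a 0).
- rewrite -EFinB lee_fin sub0r /F mulNr opprK ler_piMr//.
  by rewrite invf_le1 ?lerDl ?sqrtr_ge0// ltr_wpDr ?sqrtr_ge0.
- by move=> x _; rewrite divr_ge0 ?invr_ge0 ?sqrtr_ge0// sqr_ge0.
- exact: continuous_inv_sqrt_bound.
- rewrite -(mulr0 (- 2)); apply: cvgM; first exact: cvg_cst.
  apply/cvgrPdist_le => /= e e0; near=> x.
  have x0 : 0 < x by near: x; exact: nbhs_pinfty_gt.
  have sx : 0 < 1 + Num.sqrt x by rewrite ltr_wpDr ?sqrtr_ge0.
  rewrite sub0r normrN ger0_norm ?invr_ge0 ?(ltW sx)//.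
  rewrite -[leRHS]invrK lef_pV2 ?posrE ?invr_gt0//.
  have : e^-1 ^+ 2 <= x by near: x; apply: nbhs_pinfty_ge; rewrite num_real.
  move/ler_wsqrtr; rewrite sqrtr_sqr ger0_norm ?invr_ge0 ?(ltW e0)//.
  by move=> h; rewrite (le_trans h)// lerDr.
- move=> x ax; have /dF h : 0 < x by exact: lt_trans ax.
  exact: ex_derive.
- have /dF h := a0; apply: cvg_at_right_filter.
  by apply: differentiable_continuous; apply/derivable1_diffP; exact: ex_derive.
- move=> x; rewrite in_itv/= andbT => ax; have /dF h : 0 < x by exact: lt_trans ax.
  by rewrite derive1E derive_val.
Unshelve. all: by end_near. Qed.

Hypothesis K0 : (0 < K)%N.

(** With s = sqrt x the density is s^(K-2) exp(- s^2 / 2). Then (1+s)^(K+1) <= (K+1)! exp(1+s), and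
    1 + s - s^2 / 2 <= 3/2 is (s-1)^2 >= 0. *)
Lemma chi2_dens_le (x : R) : 0 < x ->
  dens x <= (K.+1)`!%:R * expR (3 / 2) * ((Num.sqrt x)^-1 / (1 + Num.sqrt x) ^+ 2).
Proof.
move=> x0; pose s := Num.sqrt x; have s0 : 0 < s by rewrite sqrtr_gt0.
have xs : x = s ^+ 2 by rewrite sqr_sqrtr ?ltW.
have -> : dens x = s ^+ K.-1 / s * expR (- (s ^+ 2 / 2)).
  rewrite /chi2_dens -xs; congr (_ * _).
  rewrite /s -powR12_sqrt ?(ltW x0)// -powR_mulrn ?powR_ge0// -powRrM.
  rewrite -powRB; last by rewrite (gt_eqF x0) implybT.
  congr (_ `^ _); rewrite -[in LHS](prednK K0) -natr1.
  by field.
have s1 : 0 < 1 + s by lra.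
rewrite -/s -mulrA [_^-1 * expR _]mulrC mulrA mulrC [leRHS]mulrCA ler_pM2l ?invr_gt0//.
rewrite ler_pdivlMr ?exprn_gt0//.
apply: (@le_trans _ _ ((1 + s) ^+ K.+1 * expR (- (s ^+ 2 / 2)))).
  have KE : K.+1 = (K.-1 + 2)%N by rewrite addn2 prednK.
  rewrite mulrAC ler_wpM2r ?expR_ge0// KE [leRHS]exprD.
  by rewrite ler_wpM2r ?sqr_ge0// lerXn2r ?nnegrE ?(ltW s0) ?(ltW s1)// lerDr.
apply: (@le_trans _ _ ((K.+1)`!%:R * expR (1 + s) * expR (- (s ^+ 2 / 2)))).
  by rewrite ler_wpM2r ?expR_ge0// expn_le_expR// ltW.
rewrite -mulrA ler_wpM2l// -expRD ler_expR.
have := sqr_ge0 (s - 1); nra.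
Qed.

(** The dominating integral is bounded uniformly on [1/(n+1), oo), and monotone convergence extends
    the bound down to 0. *)
Lemma integrable_chi2_dens : mu.-integrable `[0%R, +oo[ (EFin \o dens).
Proof.
apply/integrableP; split.
  by apply/measurable_EFinP; apply: measurable_funTS; exact: measurable_chi2_dens.
under eq_integral => x _ do rewrite gee0_abs ?lee_fin ?chi2_dens_ge0//.
rewrite -integral_itv_obnd_cbnd; last exact: measurable_chi2_densE.
pose F n : set R := `[n.+1%:R^-1, +oo[%classic.
have -> : `]0%R, +oo[%classic = \bigcup_n F n.
  apply/seteqP; split => x /=; rewrite in_itv/= andbT.
    move=> x0; have [n nx] := ltr_add_invr x0; exists n => //=.
    by rewrite /F/= in_itv/= andbT ltW// -[ltLHS]add0r.
  by move=> [n _]; rewrite /F/= in_itv/= andbT; apply: lt_le_trans; rewrite invr_gt0.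
have cv : (\int[mu]_(x in F n) (dens x)%:E @[n --> \oo] -->
    \int[mu]_(x in \bigcup_n F n) (dens x)%:E)%E.
  apply: ge0_nondecreasing_set_cvg_integral => //.
  - apply/nondecreasing_seqP => n; rewrite subsetEset => x; rewrite /F/= !in_itv/= !andbT.
    by apply: le_trans; rewrite lef_pV2 ?posrE// ler_nat.
  - by move=> n; exact: measurable_itv.
  - by move=> n; apply: measurable_chi2_densE; exact: measurable_itv.
  - by move=> n x _; rewrite lee_fin chi2_dens_ge0.
pose C := (K.+1)`!%:R * expR (3 / 2) : R.
have C0 : 0 <= C by rewrite mulr_ge0 ?expR_ge0.
apply: (@le_lt_trans _ _ (C%:E * 2%:E)%E); last by rewrite -EFinM ltry.
apply: (cvge_le _ cv); apply: nearW => n.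
have n0 : 0 < n.+1%:R^-1 :> R by rewrite invr_gt0.
have mg : measurable_fun (F n) (fun x => ((Num.sqrt x)^-1 / (1 + Num.sqrt x) ^+ 2)%:E).
  apply/measurable_EFinP; apply: subspace_continuous_measurable_fun; first exact: measurable_itv.
  exact: continuous_inv_sqrt_bound.
have g0 x : (0 <= ((Num.sqrt x)^-1 / (1 + Num.sqrt x) ^+ 2 : R)%:E)%E.
  by rewrite lee_fin divr_ge0 ?invr_ge0 ?sqrtr_ge0// sqr_ge0.
apply: (@le_trans _ _ (\int[mu]_(x in F n)
    (C%:E * ((Num.sqrt x)^-1 / (1 + Num.sqrt x) ^+ 2)%:E))%E).
  apply: ge0_le_integral => //.
  - exact: measurable_itv.
  - by move=> x _; rewrite lee_fin chi2_dens_ge0.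
  - by apply: measurable_chi2_densE; exact: measurable_itv.
  - exact: measurable_funeM.
  - move=> x; rewrite /F/= in_itv/= andbT => nx; rewrite -EFinM lee_fin.
    by apply: chi2_dens_le; exact: lt_le_trans nx.
have mF : measurable (F n) by exact: measurable_itv.
rewrite ge0_integralZl//; apply: lee_wpmul2l; first by rewrite lee_fin.
exact: integral_inv_sqrt_bound.
Qed.

Local Notation Z := (Rintegral mu `[0%R, +oo[ dens).

Lemma chi2_mass_gt0 : 0 < Z.
Proof.
rewrite /Rintegral fine_gt0//; apply/andP; split; last first.
  by rewrite ltey_eq; apply/orP; left; apply: integrable_fin_num => //; exact: integrable_chi2_dens.
apply: (@lt_le_trans _ _ (\int[mu]_(x in `[1%R, 2%R]) (dens x)%:E)%E); last first.
  apply: ge0_subset_integral => //; first exact: measurable_chi2_densE.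
    by move=> x _; rewrite lee_fin chi2_dens_ge0.
  by move=> x /=; rewrite !in_itv/= andbT => /andP[+ _]; apply: le_trans.
apply: (@lt_le_trans _ _ (\int[mu]_(x in `[1%R, 2%R]) (cst (expR (- 1) / 2)%:E x))%E).
  have m12 : mu `[1%R, 2%R] = 1%:E.
    by rewrite lebesgue_measure_itv/= lte_fin ltr1n/= -EFinB; congr EFin; lra.
  rewrite integral_cst// [X in (_ * X)%E](_ : _ = 1%:E); last exact: m12.
  by rewrite mule1 lte_fin divr_gt0 ?expR_gt0.
apply: ge0_le_integral => //.
- by move=> x _; rewrite lee_fin divr_ge0 ?expR_ge0.
- exact: measurable_chi2_densE.
move=> x /=; rewrite in_itv/= => /andP[x1 x2]; rewrite lee_fin mulrC /chi2_dens.
apply: ler_pM; rewrite ?expR_ge0 ?invr_ge0//; last by rewrite ler_expR; lra.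
apply: (@le_trans _ _ (x `^ (-1))).
  by rewrite powR_inv1 ?lef_pV2 ?posrE//; lra.
apply: ler_powR => //; have : (1 : R) <= K%:R by rewrite ler1n.
lra.
Qed.

Lemma chi2_dens_expR (j : nat) (x : R) : 0 <= x ->
  expR (- x) ^+ j * dens x = (1 + 2 * j%:R) `^ (1 - k) * dens ((1 + 2 * j%:R) * x).
Proof.
move=> x0; have a0 : 0 < 1 + 2 * j%:R :> R by rewrite ltr_wpDr// mulr_ge0.
rewrite /chi2_dens powRM ?(ltW a0)// !mulrA -powRD ?(gt_eqF a0) ?implybT//.
rewrite addrA subrK subrr powRr0 mul1r mulrC mulrA [RHS]mulrC; congr (_ * _).
by rewrite -expRM_natl -expRD; congr expR; field.
Qed.

Lemma integrable_expR_chi2 (j : nat) :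
  mu.-integrable `[0%R, +oo[ (EFin \o (fun x => expR (- x) ^+ j * dens x)).
Proof.
apply: (le_integrable _ _ _ integrable_chi2_dens) => //.
  apply/measurable_EFinP/measurable_funTS; apply: measurable_funM.
    by apply: measurable_funX; apply: measurableT_comp.
  exact: measurable_chi2_dens.
move=> x /=; rewrite in_itv/= andbT => x0; rewrite lee_fin normrM ler_piMl//.
by rewrite ger0_norm ?exprn_ge0 ?expR_ge0// exprn_ile1 ?expR_ge0// expR_le1 oppr_le0.
Qed.

(** The factor exp(- j x) amounts to dilating the density by 1 + 2 j, so a change of variable gives
    the transform relative to the mass [Z], whose value never has to be computed. *)
Lemma chi2_laplace (j : nat) :
  Rintegral mu `[0%R, +oo[ (fun x => expR (- x) ^+ j * dens x) =
  (1 + 2 * j%:R) `^ (- k) * Z.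
Proof.
have a0 : 0 < 1 + 2 * j%:R :> R by rewrite ltr_wpDr// mulr_ge0.
pose a : R := 1 + 2 * j%:R; rewrite -/a in a0 *.
pose E0 := (\int[mu]_(x in `[0%R, +oo[) (dens (a * x))%:E)%E.
have E0_ge0 : (0 <= E0)%E by apply: integral_ge0 => x _; rewrite lee_fin chi2_dens_ge0.
have ZE : (\int[mu]_(x in `[0%R, +oo[) (dens x)%:E = a%:E * E0)%E.
  apply: ge0_integral_scale => //; first exact: measurable_chi2_densE.
  by move=> x; rewrite lee_fin chi2_dens_ge0.
have LE : (\int[mu]_(x in `[0%R, +oo[) (expR (- x) ^+ j * dens x)%:E =
    (a `^ (1 - k))%:E * E0)%E.
  transitivity (\int[mu]_(x in `[0%R, +oo[) ((a `^ (1 - k))%:E * (dens (a * x))%:E))%E.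
    apply: eq_integral => x; rewrite inE/= in_itv/= andbT => x0.
    by rewrite -EFinM; congr EFin; exact: chi2_dens_expR.
  apply: ge0_integralZl => //.
  - apply/measurable_EFinP; apply: measurable_funTS.
    by apply: (measurableT_comp measurable_chi2_dens); exact: mulrl_measurable.
  - by move=> x _; rewrite lee_fin chi2_dens_ge0.
  - by rewrite lee_fin powR_ge0.
have : (\int[mu]_(x in `[0%R, +oo[) (dens x)%:E)%E \is a fin_num.
  by apply: integrable_fin_num => //; exact: integrable_chi2_dens.
rewrite /Rintegral LE /= ZE; case: E0 E0_ge0 {ZE LE} => [e _ _| |]//=.
  rewrite mulrA; congr (_ * _).
  by rewrite -{3}(powRr1 (ltW a0)) -powRD ?(gt_eqF a0) ?implybT// addrC.
by rewrite gt0_muley ?lte_fin.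
Qed.

End ChiSquare.

(** * Polynomials in exp(- t) under the chi-square law *)

Section ChiSquarePoly.
Variables (R : realType) (K : nat).
Local Notation mu := (@lebesgue_measure R).
Local Notation dens := (@chi2_dens R K).

(** The mean of P(exp(- X)) for X of law chi-square, read off the Laplace transform at integers. For
    K = 0 it is P(1), the mean under the point mass at 0. *)
Definition chi2_exp (P : {poly R}) : R :=
  \sum_(j < size P) P`_j * (1 + 2 * j%:R) `^ (- (K%:R / 2)).

Lemma horner_expR_dens (P : {poly R}) (x : R) :
  P.[expR (- x)] * dens x = \sum_(j < size P) P`_j * (expR (- x) ^+ j * dens x).
Proof. by rewrite horner_coef mulr_suml; apply: eq_bigr => j _; rewrite -[LHS]mulrA. Qed.

Lemma integrable_horner_chi2 (P : {poly R}) : (0 < K)%N ->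
  mu.-integrable `[0%R, +oo[ (EFin \o (fun x => P.[expR (- x)] * dens x)).
Proof.
move=> K0; rewrite (_ : EFin \o _ = fun x => \sum_(j < size P) ((P`_j)%:E *
    (EFin \o (fun x => expR (- x) ^+ j * dens x)%R) x))%E; last first.
  by apply/funext => x /=; rewrite horner_expR_dens -sumEFin.
apply: integrable_sum => // j _; apply: integrableZl => //.
exact: integrable_expR_chi2.
Qed.

Lemma Rintegral_horner_chi2 (P : {poly R}) : (0 < K)%N ->
  Rintegral mu `[0%R, +oo[ (fun x => P.[expR (- x)] * dens x) =
  chi2_exp P * Rintegral mu `[0%R, +oo[ dens.
Proof.
move=> K0; rewrite /Rintegral.
under eq_integral => x _ do rewrite horner_expR_dens -sumEFin.
rewrite integral_sum//; last first.
  move=> j; apply: (@integrableZl _ _ _ mu _ _ (P`_j)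
    (EFin \o (fun x => expR (- x) ^+ j * dens x))) => //.
  exact: integrable_expR_chi2.
have E j : (\int[mu]_(x in `[0%R, +oo[) (P`_j * (expR (- x) ^+ j * dens x))%:E =
    (P`_j * ((1 + 2 * j%:R) `^ (- (K%:R / 2)) * Rintegral mu `[0%R, +oo[ dens))%:E)%E.
  rewrite -chi2_laplace// EFinM /Rintegral fineK; last first.
    by apply: integrable_fin_num => //; exact: integrable_expR_chi2.
  by rewrite -integralZl//; exact: integrable_expR_chi2.
under eq_bigr => j _ do rewrite E.
rewrite sumEFin/= /chi2_exp mulr_suml; apply: eq_bigr => j _; by rewrite mulrA.
Qed.

Lemma integrable_step (x : R) : (0 < K)%N ->
  mu.-integrable `[0%R, +oo[ (EFin \o (fun t => (t <= x)%R%:R * dens t)).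
Proof.
move=> K0; apply: (le_integrable _ _ _ (integrable_chi2_dens R K0)) => //.
  apply/measurable_EFinP; apply: measurable_funTS.
  apply: measurable_funM; last exact: measurable_chi2_dens.
  rewrite (_ : (fun t : R => _) = \1_(`]-oo, x]%classic)).
    by apply: measurable_indic; exact: measurable_itv.
  by apply/funext => t; rewrite indicE; congr ((nat_of_bool _)%:R);
    apply/idP/idP; rewrite inE/= in_itv.
by move=> t _ /=; rewrite lee_fin normrM ler_piMl// normr_nat; case: (t <= x)%R.
Qed.

Lemma integrable_stepD (x d : R) : (0 < K)%N ->
  mu.-integrable `[0%R, +oo[ (EFin \o (fun t => ((t <= x)%R%:R + d) * dens t)).
Proof.
move=> K0; rewrite (_ : EFin \o _ = ((EFin \o (fun t => (t <= x)%R%:R * dens t)%R) \+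
    (fun t => d%:E * (EFin \o dens) t))%E); last first.
  by apply/funext => t /=; rewrite -EFinM -EFinD mulrDl.
apply: integrableD => //; first exact: integrable_step.
by apply: integrableZl => //; exact: integrable_chi2_dens.
Qed.

Lemma chi2_cdfE (x d : R) : (0 < K)%N ->
  Rintegral mu `[0%R, +oo[ (fun t => ((t <= x)%R%:R + d) * dens t) =
  (chi2_cdf K x + d) * Rintegral mu `[0%R, +oo[ dens.
Proof.
move=> K0; have Z0 := chi2_mass_gt0 R K0; have iI := integrable_step x K0.
have id : mu.-integrable `[0%R, +oo[ (EFin \o (fun t => d * dens t)).
  apply: (@integrableZl _ _ _ mu _ _ d (EFin \o dens)) => //.
  exact: integrable_chi2_dens.
under eq_Rintegral => t _ do rewrite mulrDl.
rewrite RintegralD// RintegralZl//; last exact: integrable_chi2_dens.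
rewrite mulrDl; congr (_ + _).
rewrite /chi2_cdf gtn_eqF// divfK ?gt_eqF//.
have -> : `[0%R, x]%classic = `[0%R, +oo[%classic `&` `]-oo, x]%classic :> set R.
  by apply/seteqP; split => t /=; rewrite !in_itv/= ?andbT; [move=> /andP|move=> [? ?]; apply/andP].
rewrite Rintegral_mkcondr; apply: eq_Rintegral => t _.
rewrite patchE; case: ifPn => [|/negP]; rewrite inE/= in_itv/=.
  by move=> ->; rewrite mul1r.
by move=> /negP/negbTE ->; rewrite mul0r.
Qed.

Lemma chi2_exp_le (P : {poly R}) (x d : R) :
  (forall t : R, 0 <= t -> P.[expR (- t)] <= (t <= x)%R%:R + d) ->
  chi2_exp P <= chi2_cdf K x + d.
Proof.
(* For K = 0 only t = 0 carries mass, and the hypothesis there is already the claim. *)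
move=> h; have [K0|K0] := posnP K.
  rewrite /chi2_exp /chi2_cdf K0 eqxx; have := h 0 (lexx _).
  rewrite oppr0 expR0 horner_coef; under eq_bigr do rewrite expr1n mulr1.
  under [in X in _ -> X]eq_bigr do rewrite mul0r oppr0 powRr0 mulr1.
  by case: (0 <= x)%R.
rewrite -(ler_pM2r (chi2_mass_gt0 R K0)) -Rintegral_horner_chi2// -chi2_cdfE//.
apply: le_Rintegral => //; [exact: integrable_horner_chi2|exact: integrable_stepD|].
move=> t /=; rewrite in_itv/= andbT => t0; rewrite ler_wpM2r ?chi2_dens_ge0//.
exact: h.
Qed.

Lemma chi2_exp_ge (P : {poly R}) (x d : R) :
  (forall t : R, 0 <= t -> (t <= x)%R%:R - d <= P.[expR (- t)]) ->
  chi2_cdf K x - d <= chi2_exp P.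
Proof.
move=> h; have [K0|K0] := posnP K.
  rewrite /chi2_exp /chi2_cdf K0 eqxx; have := h 0 (lexx _).
  rewrite oppr0 expR0 horner_coef; under eq_bigr do rewrite expr1n mulr1.
  under [in X in _ -> X]eq_bigr do rewrite mul0r oppr0 powRr0 mulr1.
  by case: (0 <= x)%R.
rewrite -(ler_pM2r (chi2_mass_gt0 R K0)) -Rintegral_horner_chi2// -chi2_cdfE//.
apply: le_Rintegral => //; [exact: integrable_stepD|exact: integrable_horner_chi2|].
move=> t /=; rewrite in_itv/= andbT => t0; rewrite ler_wpM2r ?chi2_dens_ge0//.
exact: h.
Qed.

End ChiSquarePoly.

(** * From Laplace transforms to distribution functions *)

Section LaplaceToCdf.
Variable R : realType.

Lemma bernoulli_ineq (w : R) (M : nat) : 0 <= w <= 1 -> 1 - M%:R * w <= (1 - w) ^+ M.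
Proof.
move=> /andP[w0 w1]; elim: M => [|M IH]; first by rewrite mul0r subr0 expr0.
rewrite exprS -natr1; have M0 : 0 <= M%:R :> R by [].
have := ler_wpM2l (_ : 0 <= 1 - w) IH; rewrite subr_ge0 => /(_ w1); nra.
Qed.

(* Kuhn's polynomials [1 - (1 - v^n)^M] with [M ~ e^(nx)] approximate, at
   [v = e^(-t)], the indicator of [t <= x]. *)
Lemma step_poly (x h d : R) : 0 < h -> 0 < d -> exists P : {poly R},
  forall t : R, 0 <= t ->
    (t <= x - h)%R%:R - d <= P.[expR (- t)] <= (t <= x + h)%R%:R + d.
Proof.
move=> h0 d0.
(* Left of the step, exp(n x) >= 2 keeps the integer part [M] above half of it, and 2 / d then gives
   M w >= 1 / d. Right of the step, exp(- n h) <= d is used. *)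
have [n hn] : exists n : nat, 2 / d + 2 <= expR (n%:R * h).
  exists (Num.truncn ((2 / d + 2) / h)).+1.
  apply: le_trans (expR_ge1Dx _).
  have := ltW (truncnS_gt ((2 / d + 2) / h)).
  by rewrite ler_pdivrMr// => H; rewrite (le_trans H)// lerDr.
have d2 : 0 < 2 / d by rewrite divr_gt0.
pose M := Num.truncn (expR (n%:R * x)).
exists (1 - (1 - 'X^n) ^+ M) => t t0.
rewrite !hornerE /=.
have -> : expR (- t) ^+ n = expR (- (n%:R * t)) by rewrite -expRM_natl mulrN.
set w := expR (- (n%:R * t)).
have w1 : 0 <= w <= 1 by rewrite expR_ge0 expR_le1 oppr_le0 mulr_ge0.
have /andP[w_ge0 w_le1] := w1.
have q1 : 0 <= (1 - w) ^+ M <= 1.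
  by rewrite exprn_ge0 ?exprn_ile1 ?subr_ge0// gerBl.
have /andP[q_ge0 q_le1] := q1.
have Mle : M%:R <= expR (n%:R * x) by rewrite truncn_le// expR_ge0.
have hE : (expR (n%:R * h))^-1 <= d.
  rewrite -[leRHS]invrK lef_pV2 ?posrE ?expR_gt0 ?invr_gt0//.
  have : d^-1 <= 2 / d by rewrite ler_peMl ?invr_ge0 ?ler1n// ltW.
  lra.
apply/andP; split.
  case: (lerP t (x - h)) => tx; last by rewrite /=; lra.
  rewrite /=; suff : (1 - w) ^+ M <= d by lra.
  have nx : expR (n%:R * h) <= expR (n%:R * x).
    by rewrite ler_expR ler_wpM2l//; lra.
  have Mge : expR (n%:R * x) / 2 <= M%:R.
    have := ltW (truncnS_gt (expR (n%:R * x))); rewrite -/M -natr1; lra.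
  have Mw : 1 / d <= M%:R * w.
    apply: (@le_trans _ _ (expR (n%:R * x) / 2 * w)); last by rewrite ler_wpM2r.
    rewrite mulrAC -expRD ler_pdivlMr//.
    apply: (@le_trans _ _ (expR (n%:R * h))); first by rewrite mulrC mulrA mulr1; lra.
    rewrite ler_expR -mulrN -mulrDr ler_wpM2l//; lra.
  apply: (@le_trans _ _ (expR (- (M%:R * w)))).
    rewrite -mulrN expRM_natl lerXn2r ?nnegrE ?subr_ge0 ?expR_ge0//.
    by have := expR_ge1Dx (- w).
  rewrite expRN -[leRHS]invrK lef_pV2 ?posrE ?expR_gt0 ?invr_gt0//.
  by rewrite (le_trans _ (expR_ge1Dx _))//; lra.
case: (lerP t (x + h)) => tx; first by rewrite /=; lra.
rewrite /=; have := bernoulli_ineq M w1.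
suff : M%:R * w <= d by lra.
apply: (@le_trans _ _ (expR (n%:R * x) * w)); first by rewrite ler_wpM2r.
rewrite -expRD (le_trans _ hE)// -expRN ler_expR -!mulrN -mulrDr ler_wpM2l//; lra.
Qed.

Variables (I K : nat) (p : 'cV[R]_I).
Hypotheses (p_gt0 : forall i, 0 < p i 0) (p_sum1 : \sum_i p i 0 = 1).
Variable T : nat -> ('I_I -> nat) -> R.
Hypothesis T_ge0 : forall N y, 0 <= T N y.
Hypothesis T_laplace : forall s : R, 0 < s ->
  mult_exp p N (fun y => expR (- s * T N y)) @[N --> \oo] --> (1 + 2 * s) `^ (- (K%:R / 2)).

Let p_ge0 i : 0 <= p i 0. Proof. exact: ltW. Qed.

Lemma mult_exp_sum N n (f : 'I_n -> ('I_I -> nat) -> R) :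
  mult_exp p N (fun y => \sum_(j < n) f j y) = \sum_(j < n) mult_exp p N (f j).
Proof.
by rewrite /mult_exp exchange_big/=; apply: eq_bigr => y _; rewrite mulr_sumr.
Qed.

Lemma mult_exp_horner_cvg (P : {poly R}) :
  mult_exp p N (fun y => P.[expR (- T N y)]) @[N --> \oo] --> chi2_exp K P.
Proof.
rewrite (_ : (fun N => _) = fun N => \sum_(j < size P) P`_j *
    mult_exp p N (fun y => expR (- (j : nat)%:R * T N y))); last first.
  apply/funext => N; under [RHS]eq_bigr do rewrite -mult_expZ.
  rewrite -mult_exp_sum; congr mult_exp; apply/funext => y; rewrite horner_coef.
  by apply: eq_bigr => j _; rewrite mulNr -mulrN expRM_natl.
rewrite /chi2_exp; apply: cvg_big => [|j _]; first exact: add_continuous.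
apply: cvgM; first exact: cvg_cst.
case: j => -[|j] jP /=; last exact: T_laplace.
rewrite (_ : (fun N => _) = fun=> 1); last first.
  apply/funext => N; rewrite -[RHS](mult_exp_cst p_sum1 N); congr mult_exp.
  by apply/funext => y; rewrite mulNr mul0r oppr0 expR0.
by rewrite mulr0 addr0 powR1; exact: cvg_cst.
Qed.

(** Polynomials in exp(- T) bracket the steps at the two thresholds, and continuity of the limit at
    x closes the gap. Comparing an arbitrary event [A] with T lets the lemma serve events that also
    involve existence of the MLE. *)
Lemma mult_prob_cvg_chi2 (A : ('I_I -> nat) -> Prop) (x : R) :
  {for x, continuous (chi2_cdf K : R -> R)} ->
  (forall e : R, 0 < e -> \forall N \near \oo, mult_prob N p (fun y =>
     ~ ((A y -> T N y <= x + e) /\ (T N y <= x - e -> A y))) <= e) ->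
  mult_prob N p A @[N --> \oo] --> (chi2_cdf K x : R).
Proof.
move=> cx hA; apply/cvgrPdist_le => /= e0 e00.
(* Five errors: continuity of the limit, the polynomial against the step under each of the two laws,
   convergence of its mean, and the exceptional event. *)
pose e := e0 / 5; have e_gt0 : 0 < e by rewrite divr_gt0.
have [h h0 hF] : exists2 h : R, 0 < h & forall z, `|x - z| < h ->
    `|chi2_cdf K x - chi2_cdf K z| <= e.
  move/cvgrPdist_le: cx => /(_ e e_gt0) /nbhs_ballP[h /= h0 hB].
  by exists h.
(* The transition zones of the polynomials are [x + r, x + 3 r] and its mirror image, inside the
   window of radius h. *)
pose r := h / 4; have r0 : 0 < r by rewrite divr_gt0.
pose c := Num.min r e; have c0 : 0 < c by rewrite lt_min r0.
have [cr ce] : c <= r /\ c <= e by rewrite !ge_min !lexx orbT.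
have [P1 hP1] := step_poly (x + 2 * r) r0 e_gt0.
have [P2 hP2] := step_poly (x - 2 * r) r0 e_gt0.
have F1 : chi2_exp K P1 <= chi2_cdf K x + e + e.
  apply: (@le_trans _ _ (chi2_cdf K (x + 3 * r) + e)).
    apply: chi2_exp_le => t t0; have /andP[_] := hP1 t t0.
    by rewrite (_ : x + 2 * r + r = x + 3 * r); last ring.
  rewrite lerD2r; have : `|x - (x + 3 * r)| < h.
    by rewrite opprD addNKr normrN gtr0_norm ?mulr_gt0// /r; lra.
  by move/hF; rewrite ler_norml => /andP[]; lra.
have F2 : chi2_cdf K x - e - e <= chi2_exp K P2.
  apply: (@le_trans _ _ (chi2_cdf K (x - 3 * r) - e)).
    rewrite lerD2r; have : `|x - (x - 3 * r)| < h.
      by rewrite opprB addrC subrK gtr0_norm ?mulr_gt0// /r; lra.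
    by move/hF; rewrite ler_norml => /andP[]; lra.
  apply: chi2_exp_ge => t t0; have /andP[+ _] := hP2 t t0.
  by rewrite (_ : x - 2 * r - r = x - 3 * r); last ring.
have /cvgrPdist_le/(_ e e_gt0) n1 := mult_exp_horner_cvg (P := P1).
have /cvgrPdist_le/(_ e e_gt0) n2 := mult_exp_horner_cvg (P := P2).
near=> N.
have E1 : `|chi2_exp K P1 - mult_exp p N (fun y => P1.[expR (- T N y)])| <= e by near: N.
have E2 : `|chi2_exp K P2 - mult_exp p N (fun y => P2.[expR (- T N y)])| <= e by near: N.
have B : mult_prob N p (fun y =>
     ~ ((A y -> T N y <= x + c) /\ (T N y <= x - c -> A y))) <= c by near: N; exact: hA.
have U1 : mult_prob N p A <= mult_prob N p (fun y => T N y <= x + r) + c.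
  apply: le_trans (lerD (lexx _) B); apply: le_trans (mult_probU _ _ _ _) => //.
  apply: mult_prob_le => // y _ Ay.
  have [[h1 _]|] := pselect ((A y -> T N y <= x + c) /\ (T N y <= x - c -> A y)).
    by left; rewrite (le_trans (h1 Ay))// lerD2l.
  by right.
have U2 : mult_prob N p (fun y => T N y <= x - r) <= mult_prob N p A + c.
  apply: le_trans (lerD (lexx _) B); apply: le_trans (mult_probU _ _ _ _) => //.
  apply: mult_prob_le => // y _ Ty.
  have [[_ h2]|] := pselect ((A y -> T N y <= x + c) /\ (T N y <= x - c -> A y)).
    by left; apply: h2; rewrite (le_trans Ty)// lerD2l lerN2.
  by right.
have V1 : mult_prob N p (fun y => T N y <= x + r) <=
    mult_exp p N (fun y => P1.[expR (- T N y)]) + e.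
  rewrite mult_probE -(mult_exp_cst p_sum1 N e) -mult_expD.
  apply: ler_mult_exp => // y _; have /andP[+ _] := hP1 (T N y) (T_ge0 N y).
  rewrite (_ : x + 2 * r - r = x + r); last ring.
  by rewrite asboolb; lra.
have V2 : mult_exp p N (fun y => P2.[expR (- T N y)]) - e <=
    mult_prob N p (fun y => T N y <= x - r).
  rewrite mult_probE lerBlDr -(mult_exp_cst p_sum1 N e) -mult_expD.
  apply: ler_mult_exp => // y _; have /andP[_] := hP2 (T N y) (T_ge0 N y).
  rewrite (_ : x - 2 * r + r = x - r); last ring.
  by rewrite asboolb.
rewrite ler_norml; move: E1 E2; rewrite !ler_norml => /andP[? ?] /andP[? ?].
have -> : e0 = 5 * e by rewrite /e; field.
by apply/andP; split; lra.
Unshelve. all: by end_near. Qed.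

End LaplaceToCdf.

(** * The residual projection *)

Section ProjectionMatrix.
Variables (R : realType) (J I : nat) (A : 'M[R]_(J, I)) (p : 'cV[R]_I).
Hypotheses (p_gt0 : forall i, 0 < p i 0) (p_sum1 : \sum_i p i 0 = 1).
Hypothesis Ap : A *m p != 0.

Definition ker_basis : 'M[R]_(dimKer A, I) := row_base (kermx A^T).

Local Notation N0 := ker_basis.
Local Notation D := (diag_mx p^T).

(* Rows: the functions [n / p - sum n], n in Ker A, i.e. the orthogonal complement in
   L^2(p) of the constants and of the tangent space of the model. *)
Definition resid_basis : 'M[R]_(dimKer A, I) :=
  \matrix_(l, i) (N0 l i / p i 0 - \sum_j N0 l j).

Local Notation C := resid_basis.

Definition resid_gram := C *m D *m C^T.

(** For w = p f, the vector S w is the L^2(p)-orthogonal projection of f on the span of the rows of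
    [resid_basis], and w' S w is its squared length. *)
Definition resid_form : 'M[R]_I := C^T *m invmx resid_gram *m C.

Local Notation S := resid_form.

Lemma ker_basisP : N0 *m A^T = 0.
Proof. by apply/sub_kermxP; rewrite eq_row_base. Qed.

Lemma resid_basisE (w : 'cV[R]_I) l :
  (C *m w) l 0 = \sum_i N0 l i * (w i 0 / p i 0) - (\sum_i N0 l i) * \sum_i w i 0.
Proof.
rewrite mxE mulr_sumr -sumrB; apply: eq_bigr => i _; rewrite mxE.
by rewrite mulrBl mulrAC mulrA.
Qed.

Lemma resid_basis_mulp : C *m p = 0.
Proof.
apply/matrixP => l k; rewrite ord1 resid_basisE p_sum1 mulr1 mxE.
under eq_bigr => i _ do rewrite divff ?gt_eqF// mulr1.
by rewrite subrr.
Qed.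

Lemma diag_mulE m (B : 'M[R]_(m, I)) i j : (B *m D) i j = B i j * p j 0.
Proof. by rewrite mul_mx_diag !mxE. Qed.

Lemma quad_diagE (v : 'rV[R]_I) : (v *m D *m v^T) 0 0 = \sum_i p i 0 * v 0 i ^+ 2.
Proof.
by rewrite mxE; apply: eq_bigr => i _; rewrite diag_mulE mxE; ring.
Qed.

(** If a combination of the rows of [C] has zero L^2(p)-length, the same combination n of the kernel
    basis equals c p. Then c A p = A n = 0 forces c = 0, and the basis is free. *)
Lemma resid_gram_unit : resid_gram \in unitmx.
Proof.
rewrite -row_free_unit; apply: inj_row_free => x xG.
have : (x *m C *m D *m (x *m C)^T) 0 0 = 0.
  rewrite trmx_mul mulmxA -[x *m C *m D]mulmxA -[x *m _ *m C^T]mulmxA -/resid_gram.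
  by rewrite xG mul0mx mxE.
rewrite quad_diagE => /eqP; rewrite psumr_eq0 => [/allP xC0|i _]; last first.
  by rewrite mulr_ge0 ?sqr_ge0// ltW.
pose c := \sum_j (x *m N0) 0 j.
have xN i : (x *m N0) 0 i = c * p i 0.
  have := xC0 i (mem_index_enum _); rewrite mulf_eq0 gt_eqF//= sqrf_eq0.
  have -> : (x *m C) 0 i = (x *m N0) 0 i / p i 0 - c.
    rewrite /c !mxE mulr_suml.
    under [X in _ = _ - X]eq_bigr do rewrite mxE.
    rewrite exchange_big -sumrB/=; apply: eq_bigr => l _.
    by rewrite mxE mulrBr mulrA mulr_sumr.
  by rewrite subr_eq0 => /eqP <-; rewrite divfK// gt_eqF.
have xNE : x *m N0 = c *: p^T by apply/rowP => i; rewrite xN !mxE.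
have c0 : c = 0.
  have : (c *: p^T) *m A^T = 0 by rewrite -xNE -mulmxA ker_basisP mulmx0.
  rewrite -scalemxAl -trmx_mul => /eqP; rewrite scaler_eq0 => /orP[/eqP//|].
  by rewrite trmx_eq0 (negbTE Ap).
apply: (row_free_inj (row_base_free (kermx A^T))).
by rewrite -/N0 xNE c0 scale0r mul0mx.
Qed.

Lemma resid_form_sym : S^T = S.
Proof.
rewrite /resid_form !trmx_mul trmxK trmx_inv mulmxA; congr (_ *m invmx _ *m _).
by rewrite /resid_gram !trmx_mul trmxK tr_diag_mx mulmxA.
Qed.

Lemma resid_form_mulp : S *m p = 0.
Proof. by rewrite /resid_form -mulmxA resid_basis_mulp mulmx0. Qed.

Lemma resid_basis_form : C *m D *m S = C.
Proof. by rewrite /resid_form !mulmxA -/resid_gram mulmxV ?mul1mx ?resid_gram_unit. Qed.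

Lemma resid_form_idem : S *m D *m S = S.
Proof.
by rewrite {1}/resid_form -!mulmxA (mulmxA C) resid_basis_form mulmxA.
Qed.

(** The trace of a projection is its rank; this is where the number of degrees of freedom comes
    from. *)
Lemma resid_form_trace : \sum_i p i 0 * S i i = (dimKer A)%:R.
Proof.
transitivity (\tr (S *m D)).
  by apply: eq_bigr => i _; rewrite diag_mulE mulrC.
rewrite /resid_form -mulmxA -mulmxA mxtrace_mulC -mulmxA -/resid_gram.
by rewrite mulVmx ?resid_gram_unit// mxtrace1.
Qed.

Definition qform (w : 'cV[R]_I) : R := (w^T *m S *m w) 0 0.

Lemma diag_colE (v : 'cV[R]_I) i : (D *m v) i 0 = p i 0 * v i 0.
Proof. by rewrite mul_diag_mx !mxE. Qed.

(** Idempotence, in the form required by [var_b]: the variance of the linear part of an increment is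
    the form itself. *)
Lemma qformE (w : 'cV[R]_I) : qform w = \sum_i p i 0 * (S *m w) i 0 ^+ 2.
Proof.
transitivity (((S *m w)^T *m D *m ((S *m w)^T)^T) 0 0); last first.
  by rewrite quad_diagE; apply: eq_bigr => i _; rewrite [_^T _ _]mxE.
by rewrite trmxK trmx_mul resid_form_sym /qform -{1}resid_form_idem !mulmxA.
Qed.

Lemma qformD (u v : 'cV[R]_I) :
  qform (u + v) = qform u + 2 * \sum_i v i 0 * (S *m u) i 0 + qform v.
Proof.
have vu : (v^T *m S *m u) 0 0 = \sum_i v i 0 * (S *m u) i 0.
  by rewrite -mulmxA mxE; apply: eq_bigr => i _; rewrite [v^T _ _]mxE.
have uv : (u^T *m S *m v) 0 0 = (v^T *m S *m u) 0 0.
  have -> : u^T *m S *m v = (v^T *m S *m u)^T.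
    by rewrite trmx_mul trmx_mul trmxK resid_form_sym mulmxA.
  by rewrite [LHS]mxE.
have addE (X Y : 'M[R]_1) : (X + Y) 0 0 = X 0 0 + Y 0 0 by rewrite mxE.
have trD : (u + v)^T = u^T + v^T by apply/rowP => i; rewrite !mxE.
by rewrite /qform trD !mulmxDl !mulmxDr !addE uv vu; ring.
Qed.

Lemma qform_delta i : qform (delta_mx i 0) = S i i.
Proof. by rewrite /qform trmx_delta -rowE -colE !mxE. Qed.

Lemma mean_resid (w : 'cV[R]_I) : \sum_i p i 0 * (S *m w) i 0 = 0.
Proof.
transitivity ((p^T *m (S *m w)) 0 0).
  by rewrite mxE; apply: eq_bigr => i _; rewrite [p^T _ _]mxE.
by rewrite mulmxA -[p^T *m S]trmxK trmx_mul trmxK resid_form_sym resid_form_mulp trmx0 mul0mx mxE.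
Qed.

Lemma row_space_of_ker_orth (m : 'cV[R]_I) : N0 *m m = 0 ->
  exists tau : 'cV[R]_J, m = A^T *m tau.
Proof.
move=> Nm; have sub : (m^T <= A)%MS.
  apply: (@submx_trans _ _ _ _ _ _ (kermx N0^T)).
    by apply/sub_kermxP; rewrite -trmx_mul Nm trmx0.
  suff: (A == kermx N0^T)%MS by move/andP => [].
  rewrite -mxrank_leqif_eq.
    rewrite mxrank_ker mxrank_tr eq_row_base /= mxrank_ker mxrank_tr.
    by rewrite subKn// rank_leq_col.
  by apply/sub_kermxP; have := congr1 trmx ker_basisP; rewrite trmx_mul trmxK trmx0.
have [t mt] := submxP sub.
by exists t^T; rewrite -[m]trmxK mt trmx_mul.
Qed.

(** The vector w/p - S w is orthogonal to every row n/p - sum n and has p-mean 0, so the constant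
    sum n drops out and it is orthogonal to Ker A in the ordinary sense; hence it lies in the row
    space. *)
Lemma resid_tangent (w : 'cV[R]_I) : \sum_i w i 0 = 0 -> exists tau : 'cV[R]_J,
  forall i, (A^T *m tau) i 0 = w i 0 / p i 0 - (S *m w) i 0.
Proof.
move=> w0; pose m : 'cV[R]_I := \col_i (w i 0 / p i 0 - (S *m w) i 0).
have [|tau mt] := @row_space_of_ker_orth m; last by exists tau => i; rewrite -mt mxE.
have subE (X Y : 'cV[R]_I) i : (X - Y) i 0 = X i 0 - Y i 0 by rewrite !mxE.
have Dm : D *m m = w - D *m (S *m w).
  apply/colP => i; rewrite diag_colE [m _ _]mxE subE diag_colE.
  by rewrite mulrBr mulrCA divff ?gt_eqF// mulr1.
have sDm : \sum_i (D *m m) i 0 = 0.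
  rewrite Dm; under eq_bigr => i _ do rewrite subE diag_colE.
  by rewrite sumrB w0 mean_resid subr0.
have CDm : C *m (D *m m) = 0.
  by rewrite Dm mulmxBr (mulmxA C D) (mulmxA _ S) resid_basis_form subrr.
apply/colP => l; have := congr1 (fun B : 'cV_ _ => B l 0) CDm.
rewrite resid_basisE sDm mulr0 subr0 => h; rewrite mxE -[RHS]h; apply: eq_bigr => i _.
by rewrite diag_colE mulrAC divff ?gt_eqF// mul1r.
Qed.

(** For w of sum 0, C w is the kernel basis applied to w/p, which ignores row-space vectors. So S w
    is controlled by any distance of w/p to the row space; for the displacement of the MLE this
    distance is of second order. *)
Lemma resid_form_tangent (w : 'cV[R]_I) (tau : 'cV[R]_J) (B : R) i :
  \sum_i w i 0 = 0 -> (forall j, `|w j 0 / p j 0 - (A^T *m tau) j 0| <= B) ->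
  `|(S *m w) i 0| <= (\sum_j `|(C^T *m invmx resid_gram *m N0) i j|) * B.
Proof.
move=> w0 hB; pose e : 'cV[R]_I := \col_j (w j 0 / p j 0 - (A^T *m tau) j 0).
have Cw : C *m w = N0 *m e.
  have -> : e = \col_j (w j 0 / p j 0) - A^T *m tau by apply/colP => j; rewrite !mxE.
  rewrite mulmxBr mulmxA ker_basisP mul0mx subr0; apply/colP => l.
  rewrite resid_basisE w0 mulr0 subr0 [RHS]mxE; apply: eq_bigr => j _.
  by rewrite [(\col__ _) _ _]mxE.
rewrite /resid_form -mulmxA Cw mulmxA mxE (le_trans (ler_norm_sum _ _ _))// mulr_suml.
by apply: ler_sum => j _; rewrite normrM ler_wpM2l// mxE; exact: hB.
Qed.

(** Bessel's inequality: the gap is the squared L^2(p)-length of w/p - S w. *)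
Lemma qform_le (w : 'cV[R]_I) : qform w <= \sum_i w i 0 ^+ 2 / p i 0.
Proof.
have : 0 <= \sum_i p i 0 * (w i 0 / p i 0 - (S *m w) i 0) ^+ 2.
  by apply: sumr_ge0 => i _; rewrite mulr_ge0 ?sqr_ge0// ltW.
have -> : \sum_i p i 0 * (w i 0 / p i 0 - (S *m w) i 0) ^+ 2 =
    \sum_i w i 0 ^+ 2 / p i 0 - 2 * \sum_i w i 0 * (S *m w) i 0 + qform w.
  rewrite qformE mulr_sumr -sumrB -big_split/=; apply: eq_bigr => i _.
  by field; rewrite gt_eqF.
have -> : \sum_i w i 0 * (S *m w) i 0 = qform w.
  by rewrite /qform -mulmxA mxE; apply: eq_bigr => i _; rewrite [w^T _ _]mxE.
lra.
Qed.

End ProjectionMatrix.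

(** * Local expansion of the divergences *)

Section LogBounds.
Variable R : realType.
Implicit Types t u v : R.

Local Notation e1 := (expR 1 : R).

Lemma norm_ln1D t : `|t| <= 1 / 2 -> `|ln (1 + t)| <= 2 * `|t|.
Proof.
move=> th; have := th; rewrite ler_norml => /andP[t1 t2].
have tp : 0 < 1 + t by lra.
have u1 : ln (1 + t) <= t by apply: le_ln1Dx; lra.
have u2 : - (2 * `|t|) <= ln (1 + t).
  have i0 : 0 < (1 + t)^-1 by rewrite invr_gt0.
  have : ln (1 + ((1 + t)^-1 - 1)) <= (1 + t)^-1 - 1 by apply: le_ln1Dx; lra.
  rewrite [1 + (_ - 1)]addrC subrK lnV ?posrE// => h.
  suff : (1 + t)^-1 - 1 <= 2 * `|t| by lra.
  rewrite lerBlDr -[leLHS]mul1r ler_pdivrMr//.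
  by have := ler_norm t; have := ler_norm (- t); rewrite normrN; nra.
by rewrite ler_norml u2 (le_trans u1)// (le_trans (ler_norm t))// ler_peMl// ler1n.
Qed.

(** Inverts the expansion of exp at s = ln(1 + t); the powers of 2 come from |s| <= 2 |t|. *)
Lemma ln1D_taylor t : `|t| <= 1 / 2 ->
  `|ln (1 + t) - t| <= 4 * e1 * t ^+ 2 /\
  `|ln (1 + t) - t + t ^+ 2 / 2| <= 8 * (2 * e1 + e1 ^+ 2) * `|t| ^+ 3.
Proof.
move=> th; have := th; rewrite ler_norml => /andP[t1 t2].
have tp : 0 < 1 + t by lra.
pose s := ln (1 + t); have st : `|s| <= 2 * `|t| by exact: norm_ln1D.
have s1 : `|s| <= 1 by lra.
have es : expR s = 1 + t by rewrite lnK ?posrE.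
have Es : expR `|s| <= e1 by rewrite ler_expR.
have e0 : 0 < e1 := expR_gt0 1.
have s2 : s ^+ 2 = `|s| ^+ 2 by rewrite real_normK ?num_real.
have t2E : t ^+ 2 = `|t| ^+ 2 by rewrite real_normK ?num_real.
have s20 : 0 <= `|s| ^+ 2 by rewrite exprn_ge0.
have s30 : 0 <= `|s| ^+ 3 by rewrite exprn_ge0.
pose r2 := t - s; pose r3 := t - s - s ^+ 2 / 2.
have h2 : `|r2| <= `|s| ^+ 2 * e1.
  have := expR_taylor2 s; rewrite es s2 => h.
  rewrite /r2 (_ : t - s = 1 + t - 1 - s); last by ring.
  by rewrite (le_trans h)// ler_wpM2l.
have h3 : `|r3| <= `|s| ^+ 3 * e1.
  have := expR_taylor3 s; rewrite es => h.
  rewrite /r3 (_ : t - s - s ^+ 2 / 2 = 1 + t - 1 - s - s ^+ 2 / 2); last by ring.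
  by rewrite (le_trans h)// ler_wpM2l.
have st2 : `|s| ^+ 2 <= 4 * `|t| ^+ 2.
  rewrite (_ : 4 * `|t| ^+ 2 = (2 * `|t|) ^+ 2); last by ring.
  by rewrite lerXn2r ?nnegrE ?mulr_ge0.
have st3 : `|s| ^+ 3 <= 8 * `|t| ^+ 3.
  rewrite (_ : 8 * `|t| ^+ 3 = (2 * `|t|) ^+ 3); last by ring.
  by rewrite lerXn2r ?nnegrE ?mulr_ge0.
split.
  by rewrite distrC -/s -/r2 (le_trans h2)// t2E [leRHS]mulrAC ler_wpM2r// ltW.
(* With t = s + r2 the square t^2 / 2 is s^2 / 2 + s r2 + r2^2 / 2, and s^2 / 2 completes - r3. *)
rewrite -/s (_ : s - t + t ^+ 2 / 2 = - r3 + (s * r2 + r2 ^+ 2 / 2)); last first.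
  by rewrite /r3 /r2; field.
have h4 : `|s * r2| <= `|s| ^+ 3 * e1.
  by rewrite normrM exprS -mulrA ler_wpM2l.
have h5 : `|r2 ^+ 2 / 2| <= `|s| ^+ 3 * e1 ^+ 2.
  have r22 : r2 ^+ 2 <= (`|s| ^+ 2 * e1) ^+ 2.
    rewrite -[leLHS]real_normK ?num_real// lerXn2r ?nnegrE// mulr_ge0// ltW//.
  have q0 : 0 <= r2 ^+ 2 := sqr_ge0 _.
  rewrite ger0_norm ?divr_ge0//; apply: (@le_trans _ _ (r2 ^+ 2)); first by lra.
  rewrite (le_trans r22)// exprMn ler_wpM2r ?sqr_ge0//.
  by rewrite -exprM (_ : (2 * 2)%N = 4%N)// exprS ler_piMl.
rewrite (le_trans (ler_normD _ _))// normrN.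
have := ler_normD (s * r2) (r2 ^+ 2 / 2).
have c0 : 0 <= 2 * e1 + e1 ^+ 2 by rewrite addr_ge0 ?sqr_ge0// mulr_ge0// ltW.
have := ler_wpM2l c0 st3; lra.
Qed.

(** 16 is the 8 of the cubic remainder of ln times the bound 2 on |1 + t|; the 1 covers t^3 / 2. *)
Definition kl_const : R := 1 + 16 * (2 * e1 + e1 ^+ 2).

Lemma kl_const_ge0 : 0 <= kl_const.
Proof.
have e0 : 0 < e1 := expR_gt0 1.
by rewrite /kl_const; have := sqr_ge0 e1; lra.
Qed.

Definition kl_term u v := u * ln (u / v) - (u - v).

Lemma kl_term_local u v : 0 < u -> 0 < v -> `|u - v| <= v / 2 ->
  `|kl_term u v - (u - v) ^+ 2 / (2 * v)| <= kl_const * `|u - v| ^+ 3 / v ^+ 2.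
Proof.
move=> u0 v0 uv; pose t := (u - v) / v.
have v_neq0 : v != 0 by rewrite gt_eqF.
have tE : `|t| = `|u - v| / v by rewrite normrM normfV (gtr0_norm v0).
have th : `|t| <= 1 / 2 by rewrite tE ler_pdivrMr//; lra.
have [_ h] := ln1D_taylor th.
have uE : u / v = 1 + t by rewrite /t; field.
have -> : kl_term u v - (u - v) ^+ 2 / (2 * v) =
    v * ((1 + t) * (ln (1 + t) - t + t ^+ 2 / 2) - t ^+ 3 / 2).
  rewrite /kl_term uE; have -> : u = v * (1 + t) by rewrite /t; field.
  by field.
rewrite normrM (gtr0_norm v0).
have -> : kl_const * `|u - v| ^+ 3 / v ^+ 2 = v * (kl_const * `|t| ^+ 3).
  by rewrite tE; field.
rewrite ler_pM2l// (le_trans (ler_normB _ _))// [`|(1 + t) * _|]normrM.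
rewrite (_ : `|t ^+ 3 / 2| = `|t| ^+ 3 / 2); last first.
  by rewrite normf_div normrX (@ger0_norm _ 2).
have t1 : `|1 + t| <= 2.
  by rewrite (le_trans (ler_normD _ _))// normr1; lra.
have t3 : 0 <= `|t| ^+ 3 by rewrite exprn_ge0.
have := ler_pM (normr_ge0 _) (normr_ge0 _) t1 h.
rewrite /kl_const; lra.
Qed.

Lemma kl_term_le u v : 0 < u -> 0 < v -> kl_term u v <= (u - v) ^+ 2 / v.
Proof.
move=> u0 v0; have uv0 : 0 < u / v by rewrite divr_gt0.
have : ln (1 + (u / v - 1)) <= u / v - 1 by apply: le_ln1Dx; lra.
rewrite addrC subrK => h; have := ler_wpM2l (ltW u0) h.
have -> : (u - v) ^+ 2 / v = u * (u / v - 1) - (u - v) by field; rewrite gt_eqF.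
by rewrite /kl_term lerD2r.
Qed.

(** The Hellinger bound: ln x <= x - 1 at x = sqrt(v/u) gives (sqrt u - sqrt v)^2, and sqrt u + sqrt
    v <= 2. *)
Lemma kl_term_ge u v : 0 < u <= 1 -> 0 < v <= 1 -> (u - v) ^+ 2 / 4 <= kl_term u v.
Proof.
move=> /andP[u0 u1] /andP[v0 v1].
pose a := Num.sqrt u; pose b := Num.sqrt v.
have a0 : 0 < a by rewrite sqrtr_gt0.
have b0 : 0 < b by rewrite sqrtr_gt0.
have ua : u = a ^+ 2 by rewrite sqr_sqrtr// ltW.
have vb : v = b ^+ 2 by rewrite sqr_sqrtr// ltW.
have a1 : a <= 1 by rewrite -sqrtr1 ler_wsqrtr.
have b1 : b <= 1 by rewrite -sqrtr1 ler_wsqrtr.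
have ba : 0 < b / a by rewrite divr_gt0.
have : ln (1 + (b / a - 1)) <= b / a - 1 by apply: le_ln1Dx; lra.
rewrite addrC subrK => h.
have lnE : ln (u / v) = - 2 * ln (b / a).
  rewrite ua vb -[b / a]invrK lnV ?posrE ?invr_gt0// invf_div mulrNN.
  by rewrite -expr_div_n lnXn ?divr_gt0// mulr_natl.
have lb : (a - b) ^+ 2 <= kl_term u v.
  rewrite /kl_term lnE; have := ler_wpM2l (ltW u0) h.
  have -> : u * (b / a - 1) = a * b - a ^+ 2.
    by rewrite ua; field; rewrite gt_eqF.
  by rewrite [in X in _ - (X - _)]ua vb; nra.
apply: le_trans lb; rewrite ua vb.
have -> : a ^+ 2 - b ^+ 2 = (a - b) * (a + b) by ring.
rewrite exprMn -mulrA ler_piMr ?sqr_ge0//; nra.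
Qed.

End LogBounds.

(** * Both divergences at points close to p *)

Section Statistics.
Variables (R : realType) (I : nat).

Lemma bregman_scale (N : R) (u v : 'I_I -> R) : 0 < N -> (forall i, 0 < u i) ->
  (forall i, 0 < v i) ->
  bregman (fun i => N * u i) (fun i => N * v i) = N * (2 * \sum_i kl_term (u i) (v i)).
Proof.
move=> N0 u0 v0; rewrite /bregman mulrCA; congr (_ * _); rewrite mulr_sumr.
apply: eq_bigr => i _; rewrite gt_eqF ?mulr_gt0// -mulf_div divff ?gt_eqF// mul1r.
by rewrite /kl_term; ring.
Qed.

Lemma pearson_scale (N : R) (u v : 'I_I -> R) : 0 < N -> (forall i, 0 < v i) ->
  pearson (fun i => N * u i) (fun i => N * v i) = N * \sum_i (u i - v i) ^+ 2 / v i.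
Proof.
move=> N0 v0; rewrite /pearson mulr_sumr; apply: eq_bigr => i _.
by field; rewrite !gt_eqF.
Qed.

Variable p : 'I_I -> R.
Hypothesis p_gt0 : forall i, 0 < p i.

Lemma ex_lower_bound : exists2 m : R, 0 < m & forall i, m <= p i.
Proof.
exists (1 + \sum_i (p i)^-1)^-1 => [|i].
  by rewrite invr_gt0 ltr_wpDr// sumr_ge0// => i _; rewrite invr_ge0 ltW.
rewrite -[leRHS]invrK lef_pV2 ?posrE ?invr_gt0//; last first.
  by rewrite ltr_wpDr// sumr_ge0// => j _; rewrite invr_ge0 ltW.
rewrite (bigD1 i)//= addrCA lerDl addr_ge0// sumr_ge0// => j _.
by rewrite invr_ge0 ltW.
Qed.

(** At displacements e w and e z from p both statistics are, after division by e^2, the same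
    weighted square: the third-order term of the Bregman divergence and the change of denominator
    from p + e z to p cost O(e) each. *)
Lemma local_approx (M : R) : 0 <= M -> exists2 C : R, 0 <= C & exists2 e0 : R, 0 < e0 &
  forall (e : R) (w z : 'I_I -> R), 0 < e <= e0 ->
    (forall i, `|w i| <= M) -> (forall i, `|z i| <= M) ->
  [/\ forall i, 0 < p i + e * w i, forall i, 0 < p i + e * z i,
    `|(e ^+ 2)^-1 * (\sum_i (p i + e * w i - (p i + e * z i)) ^+ 2 / (p i + e * z i))
      - \sum_i (w i - z i) ^+ 2 / p i| <= C * e &
    `|(e ^+ 2)^-1 * (2 * \sum_i kl_term (p i + e * w i) (p i + e * z i))
      - \sum_i (w i - z i) ^+ 2 / p i| <= C * e].
Proof.
move=> M0; have [m m0 mp] := ex_lower_bound.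
pose C1 := 8 * M ^+ 3 / m ^+ 2; pose C2 := 64 * kl_const R * M ^+ 3 / m ^+ 2.
have C10 : 0 <= C1 by rewrite divr_ge0 ?sqr_ge0// mulr_ge0// exprn_ge0.
have C20 : 0 <= C2.
  by rewrite divr_ge0 ?sqr_ge0// mulr_ge0 ?exprn_ge0// mulr_ge0// kl_const_ge0.
exists (I%:R * (C1 + C2)); first by rewrite mulr_ge0// addr_ge0.
(* Gives e M <= m / 8, so both points stay above p / 2 and differ by at most half of the second one,
   as [kl_term_local] requires. *)
exists (m / (8 * (M + 1))); first by rewrite divr_gt0// mulr_gt0//; lra.
move=> e w z /andP[e0 ee] wM zM.
have eM : e * M <= m / 8.
  move: ee; rewrite ler_pdivlMr; last by rewrite mulr_gt0//; lra.
  nra.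
have bnd (t : R) : `|t| <= M -> `|e * t| <= m / 8.
  by move=> tM; rewrite normrM (gtr0_norm e0) (le_trans _ eM)// ler_wpM2l// ltW.
have pos (t : 'I_I -> R) (i : 'I_I) : `|t i| <= M -> p i / 2 <= p i + e * t i.
  by move=> /bnd; rewrite ler_norml => /andP[h _]; have := mp i; lra.
have upos i : 0 < p i + e * w i.
  by have := pos w i (wM i); have := p_gt0 i; lra.
have vpos i : 0 < p i + e * z i.
  by have := pos z i (zM i); have := p_gt0 i; lra.
have ev2 : (e ^+ 2) != 0 by rewrite expf_neq0// gt_eqF.
have wz i : `|w i - z i| <= 2 * M.
  by rewrite (le_trans (ler_normB _ _))//; have := wM i; have := zM i; lra.
have vm i : m / 2 <= p i + e * z i by have := pos z i (zM i); have := mp i; lra.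
have T1 i : `|(w i - z i) ^+ 2 / (p i + e * z i) - (w i - z i) ^+ 2 / p i| <= C1 * e.
  have -> : (w i - z i) ^+ 2 / (p i + e * z i) - (w i - z i) ^+ 2 / p i =
     (w i - z i) ^+ 2 * (- (e * z i)) / ((p i + e * z i) * p i).
    by field; rewrite !gt_eqF.
  have d0 : 0 < (p i + e * z i) * p i by rewrite mulr_gt0.
  rewrite normrM normfV (gtr0_norm d0) ler_pdivrMr// normrM normrX normrN normrM (gtr0_norm e0).
  apply: (@le_trans _ _ ((2 * M) ^+ 2 * (e * M))).
    apply: ler_pM; rewrite ?exprn_ge0 ?mulr_ge0 ?(ltW e0)//.
      by rewrite lerXn2r ?nnegrE ?mulr_ge0.
    by rewrite ler_wpM2l ?(ltW e0).
  have dm : m ^+ 2 / 2 <= (p i + e * z i) * p i.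
    have -> : m ^+ 2 / 2 = m / 2 * m by field.
    by apply: ler_pM => //; [rewrite divr_ge0// ltW|exact: ltW].
  have C1e : 0 <= C1 * e by rewrite mulr_ge0// ltW.
  apply: le_trans (ler_wpM2l C1e dm).
  have -> : C1 * e * (m ^+ 2 / 2) = (2 * M) ^+ 2 * (e * M); last exact: lexx.
  by rewrite /C1; field; rewrite gt_eqF.
have T2 i : `|(e ^+ 2)^-1 * (2 * kl_term (p i + e * w i) (p i + e * z i)) -
     (w i - z i) ^+ 2 / (p i + e * z i)| <= C2 * e.
  set u := p i + e * w i; set v := p i + e * z i.
  have uvE : u - v = e * (w i - z i) by rewrite /u /v; ring.
  have uvn : `|u - v| = e * `|w i - z i| by rewrite uvE normrM (gtr0_norm e0).
  have uv2 : `|u - v| <= v / 2.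
    rewrite uvn; have := vm i; rewrite -/v; have := ler_wpM2l (ltW e0) (wz i); lra.
  have v_neq0 : v != 0 by rewrite gt_eqF// /v.
  have v0 : 0 < v := vpos i.
  have K := kl_term_local (upos i : 0 < u) v0 uv2.
  have -> : (e ^+ 2)^-1 * (2 * kl_term u v) - (w i - z i) ^+ 2 / v =
      2 / e ^+ 2 * (kl_term u v - (u - v) ^+ 2 / (2 * v)).
    by rewrite uvE; field; rewrite v_neq0 gt_eqF.
  rewrite normrM ger0_norm ?divr_ge0 ?sqr_ge0//.
  have e20 : 0 <= 2 / e ^+ 2 by rewrite divr_ge0// sqr_ge0.
  apply: le_trans (ler_wpM2l e20 K) _.
  rewrite uvn mulrA ler_pdivrMr ?exprn_gt0//.
  have -> : 2 / e ^+ 2 * (kl_const R * (e * `|w i - z i|) ^+ 3) =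
     2 * kl_const R * e * `|w i - z i| ^+ 3 by field; rewrite gt_eqF.
  have k0 : 0 <= 2 * kl_const R * e.
    by rewrite mulr_ge0 ?(ltW e0)// mulr_ge0// kl_const_ge0.
  have wz3 : `|w i - z i| ^+ 3 <= (2 * M) ^+ 3 by rewrite lerXn2r ?nnegrE ?mulr_ge0.
  apply: le_trans (ler_wpM2l k0 wz3) _.
  have vm2 : m ^+ 2 / 4 <= v ^+ 2.
    have -> : m ^+ 2 / 4 = (m / 2) ^+ 2 by field.
    by rewrite lerXn2r ?nnegrE ?divr_ge0 ?(ltW m0) ?(ltW v0)//; exact: vm.
  have C2e : 0 <= C2 * e by rewrite mulr_ge0// ltW.
  apply: le_trans (ler_wpM2l C2e vm2).
  have -> : C2 * e * (m ^+ 2 / 4) = 2 * kl_const R * e * (2 * M) ^+ 3; last exact: lexx.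
  by rewrite /C2; field; rewrite gt_eqF.
have sumI (f : 'I_I -> R) B : (forall i, `|f i| <= B) -> `|\sum_i f i| <= I%:R * B.
  move=> fB; rewrite (le_trans (ler_norm_sum _ _ _))//.
  rewrite (_ : I%:R * B = \sum_(i < I) B); last by rewrite sumr_const card_ord mulr_natl.
  by apply: ler_sum => i _.
have C2e : 0 <= C2 * e by rewrite mulr_ge0// ltW.
split => //.
  rewrite mulr_sumr -sumrB -mulrA; apply: sumI => i; rewrite mulrDl.
  have -> : (e ^+ 2)^-1 * ((p i + e * w i - (p i + e * z i)) ^+ 2 / (p i + e * z i)) =
     (w i - z i) ^+ 2 / (p i + e * z i) by field; rewrite !gt_eqF.
  by have := T1 i; lra.
rewrite !mulr_sumr -sumrB -mulrA; apply: sumI => i; rewrite [(C1 + C2) * e]mulrDl.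
rewrite -(subrKA ((w i - z i) ^+ 2 / (p i + e * z i))) (le_trans (ler_normD _ _))//.
by have := T1 i; have := T2 i; lra.
Qed.

End Statistics.

(** * Existence and expansion of the MLE *)

Section MLE.
Variables (R : realType) (J I : nat) (A : 'M[R]_(J, I)).

Lemma RM_expR (v : 'rV[R]_I) : (v <= A)%MS -> \sum_i expR (v 0 i) = 1 ->
  RM A (\col_i expR (v 0 i)).
Proof.
move=> /submxP[t vt] v1; split; first by move=> i; rewrite mxE expR_gt0.
split; first by rewrite -[RHS]v1; apply: eq_bigr => i _; rewrite mxE.
by exists t^T; rewrite -trmx_mul -vt; apply/colP => i; rewrite !mxE expRK.
Qed.

Lemma RM_ln (q : 'cV[R]_I) : RM A q ->
  ((\row_i ln (q i 0)) <= A)%MS /\ \sum_i expR ((\row_i ln (q i 0)) 0 i) = 1.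
Proof.
move=> [q0 [q1 [t qt]]]; split.
  apply/submxP; exists t^T; rewrite -[A]trmxK -trmx_mul -qt.
  by apply/rowP => i; rewrite !mxE.
by rewrite -[RHS]q1; apply: eq_bigr => i _; rewrite mxE lnK// posrE.
Qed.

(** In log coordinates the members at least as likely as p form a compact set: coordinates are at
    most 0 because probabilities are at most 1, and since every count is at least 1, no coordinate
    can fall below the log-likelihood of p. *)
Lemma mle_exists (y : 'I_I -> nat) (p : 'cV[R]_I) : RM A p ->
  (forall i, (0 < y i)%N) -> MLE_exists A y.
Proof.
move=> pRM y0.
pose f (v : 'rV[R]_I) : R := \sum_i (y i)%:R * v 0 i.
pose g (v : 'rV[R]_I) : R := \sum_i expR (v 0 i).
(* A continuous function vanishing exactly on the row space, so that this constraint is closed. *)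
pose h (v : 'rV[R]_I) : R := \sum_j `|\sum_i cokermx A i j * v 0 i|.
have cokE (v : 'rV[R]_I) j : \sum_i cokermx A i j * v 0 i = (v *m cokermx A) 0 j.
  by rewrite mxE; apply: eq_bigr => i _; rewrite mulrC.
have fE (q : 'cV[R]_I) : f (\row_i ln (q i 0)) = loglik y q.
  by rewrite /f /loglik; apply: eq_bigr => i _; rewrite mxE.
have hE v : (h v = 0) <-> (v <= A)%MS.
  rewrite submxE; split=> [hv|/eqP hv].
    apply/eqP/rowP => j; rewrite -cokE [RHS]mxE; move/eqP: hv; rewrite psumr_eq0 => [|i _].
      by move/allP/(_ j (mem_index_enum _)); rewrite normr_eq0 => /eqP.
    exact: normr_ge0.
  by rewrite /h big1// => j _; rewrite cokE hv mxE normr0.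
have coordc i : continuous (fun v : 'rV[R]_I => v 0 i) by exact: coord_continuous.
have fc : continuous f.
  apply: continuous_big => [|i _]; first exact: add_continuous.
  by move=> v; apply: (continuous_comp (coordc i v)); exact: mulrl_continuous.
have gc : continuous g.
  apply: continuous_big => [|i _]; first exact: add_continuous.
  by move=> v; apply: (continuous_comp (coordc i v)); exact: continuous_expR.
have hc : continuous h.
  apply: continuous_big => [|j _]; first exact: add_continuous.
  have lc : continuous (fun v : 'rV[R]_I => \sum_i cokermx A i j * v 0 i).
    apply: continuous_big => [|i _]; first exact: add_continuous.
    by move=> v; apply: (continuous_comp (coordc i v)); exact: mulrl_continuous.
  by move=> v; apply: (continuous_comp (lc v)); exact: norm_continuous.
pose c := loglik y p.
pose V := [set v | h v = 0] `&` ([set v | g v = 1] `&` [set v | c <= f v]).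
have pre (F : 'rV[R]_I -> R) (D : set R) : continuous F -> closed D -> closed (F @^-1` D).
  by move=> Fc; apply: closed_comp => v _; exact: Fc.
have Vcl : closed V.
  have c1 : closed [set v : 'rV[R]_I | h v = 0] := pre h [set t | t = 0] hc (@closed_eq _ 0).
  have c2 : closed [set v : 'rV[R]_I | g v = 1] := pre g [set t | t = 1] gc (@closed_eq _ 1).
  have c3 : closed [set v : 'rV[R]_I | c <= f v] := pre f [set t | c <= t] fc (@closed_ge _ c).
  exact: closedI c1 (closedI c2 c3).
have Vneg v : V v -> forall i, v 0 i <= 0.
  move=> [_ [/= gv _]] i; rewrite -expR_le1 -gv /g (bigD1 i)//= lerDl.
  by rewrite sumr_ge0// => k _; exact: expR_ge0.
have Vlow v : V v -> forall i, c <= v 0 i.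
  move=> Vv i; have [_ [_ /= cf]] := Vv; rewrite (le_trans cf)// /f (bigD1 i)//=.
  rewrite -[leRHS]addr0 lerD//.
    have : (1 : R) <= (y i)%:R by rewrite ler1n.
    have := Vneg v Vv i; nra.
  by rewrite sumr_le0// => k _; rewrite mulr_ge0_le0// Vneg.
have Vc : compact V.
  apply: (subclosed_compact Vcl (@rV_compact _ _ (fun _ : 'I_I => `[c, 0]%classic) _)).
    by move=> _; exact: segment_compact.
  by move=> v Vv i /=; rewrite in_itv/= Vlow// Vneg.
have Vp q : RM A q -> c <= loglik y q -> V (\row_i ln (q i 0)).
  by move=> /RM_ln[qA q1] cq; split; [exact/hE|split => //=; rewrite fE].
have V0 : V !=set0 by exists (\row_i ln (p i 0)); exact: Vp.
have [v /set_mem Vv vmax] := EVT_max_rV V0 Vc (continuous_subspaceT fc).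
have [/= /hE vA [/= v1 cf]] := Vv.
have vE : loglik y (\col_i expR (v 0 i)) = f v.
  by apply: eq_bigr => i _; rewrite mxE expRK.
exists (\col_i expR (v 0 i)); split; first exact: RM_expR.
move=> q qRM; rewrite vE; have [cq|/ltW cq] := leP c (loglik y q).
  by rewrite -fE; apply: vmax; apply: mem_set; exact: Vp.
exact: le_trans cf.
Qed.

Variable p : 'cV[R]_I.
Hypotheses (A01 : zero_one_mx A) (A1 : col_has_one A) (pRM : RM A p).

Let p_gt0 i : 0 < p i 0. Proof. by case: pRM. Qed.
Let p_sum1 : \sum_i p i 0 = 1. Proof. by case: pRM => _ []. Qed.

Lemma p_le1 i : p i 0 <= 1.
Proof. by rewrite -p_sum1 (bigD1 i)//= lerDl sumr_ge0// => j _; exact: ltW. Qed.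

Lemma colsum_bounds i : 1 <= (A^T *m const_mx 1 : 'cV[R]_I) i 0 <= J%:R.
Proof.
have -> : (A^T *m const_mx 1 : 'cV[R]_I) i 0 = \sum_j A j i.
  by rewrite mxE; apply: eq_bigr => j _; rewrite !mxE mulr1.
have A_ge0 j : 0 <= A j i by case: (A01 j i) => ->.
apply/andP; split.
  by have [j Aj] := A1 i; rewrite (bigD1 j)//= Aj lerDl sumr_ge0.
rewrite (_ : J%:R = \sum_(j < J) 1); last by rewrite sumr_const card_ord.
by apply: ler_sum => j _; case: (A01 j i) => ->.
Qed.

(* Moving along a tangent direction leaves the probability simplex at second order;
   this is corrected along [A' 1], whose entries are at least 1. *)
Lemma ex_competitor (X : R) : 0 <= X -> exists2 C : R, 0 <= C & exists2 e0 : R, 0 < e0 &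
  forall (e : R) (tau : 'cV[R]_J), 0 < e <= e0 ->
    (forall i, `|(A^T *m tau) i 0| <= X) -> \sum_i p i 0 * (A^T *m tau) i 0 = 0 ->
  exists2 q, RM A q &
    forall i, `|(q i 0 - p i 0) / (e * p i 0) - (A^T *m tau) i 0| <= C * e.
Proof.
move=> X0; pose k := X ^+ 2 * expR X.
have k0 : 0 <= k by rewrite mulr_ge0 ?sqr_ge0 ?expR_ge0.
pose U := X + 2 * k * J%:R.
have U0 : 0 <= U by rewrite addr_ge0// !mulr_ge0.
exists (U ^+ 2 * expR U + 2 * k * J%:R).
  by rewrite addr_ge0 ?mulr_ge0 ?sqr_ge0 ?expR_ge0// mulr_ge0.
(* Gives e <= 1 and K = e^2 k <= 1/2. *)
exists (1 + 2 * k)^-1; first by rewrite invr_gt0; lra.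
move=> e tau /andP[e0 ee] xX sx.
have k1 : 0 < 1 + 2 * k by lra.
have ek : e * (1 + 2 * k) <= 1 by rewrite -ler_pdivlMr// mul1r.
have e1 : e <= 1 by nra.
have e_ge0 := ltW e0.
set x := A^T *m tau in xX sx *.
pose a : 'cV[R]_I := A^T *m const_mx 1.
have a1 i : 1 <= a i 0 by have /andP[] := colsum_bounds i.
have aJ i : a i 0 <= J%:R by have /andP[] := colsum_bounds i.
pose K := e ^+ 2 * k.
have K0 : 0 <= K by rewrite mulr_ge0 ?sqr_ge0.
have Kh : K <= 1 / 2 by rewrite /K; nra.
pose G s := \sum_i p i 0 * expR (e * x i 0 + s * a i 0).
have G0 : `|G 0 - 1| <= K.
  have -> : G 0 - 1 = \sum_i p i 0 * (expR (e * x i 0) - 1 - e * x i 0).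
    have -> : \sum_i p i 0 * (expR (e * x i 0) - 1 - e * x i 0) =
        G 0 - \sum_i p i 0 - e * \sum_i p i 0 * x i 0.
      rewrite /G mulr_sumr -!sumrB; apply: eq_bigr => i _; rewrite mul0r addr0; ring.
    by rewrite sx mulr0 subr0 p_sum1.
  apply: (@norm_mean _ _ (fun i => p i 0)) => // i.
  have xe : `|e * x i 0| <= e * X by rewrite normrM (gtr0_norm e0) ler_wpM2l.
  rewrite (le_trans (expR_taylor2 _))// -[(e * x i 0) ^+ 2]real_normK ?num_real//.
  rewrite /K /k mulrA -exprMn; apply: ler_pM; rewrite ?exprn_ge0 ?expR_ge0//.
    by rewrite lerXn2r ?nnegrE ?mulr_ge0.
  by rewrite ler_expR (le_trans xe)// ler_piMl.
have := G0; rewrite ler_norml => /andP[Ga Gb].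
(* The mass at s = 0 is within K of 1. As a_i >= 1, moving s by 2 K scales it by at least exp(2 K)
   up or down, and (1 - K)(1 + 2 K) >= 1 for K <= 1/2; the correct s lies in between. *)
have Gup : 1 <= G (2 * K).
  apply: (@le_trans _ _ (G 0 * expR (2 * K))).
    have := expR_ge1Dx (2 * K) => h.
    have : (1 - K) * (1 + 2 * K) <= G 0 * expR (2 * K).
      by apply: ler_pM => //; lra.
    nra.
  rewrite /G mulr_suml; apply: ler_sum => i _.
  rewrite -mulrA -expRD ler_wpM2l ?(ltW (p_gt0 i))// ler_expR mul0r addr0 lerD2l.
  by rewrite ler_peMr// mulr_ge0.
have Gdown : G (- (2 * K)) <= 1.
  apply: (@le_trans _ _ (G 0 * expR (- (2 * K)))).
    rewrite /G mulr_suml; apply: ler_sum => i _.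
    rewrite -mulrA -expRD ler_wpM2l ?(ltW (p_gt0 i))// ler_expR mul0r addr0 lerD2l.
    by rewrite mulNr lerN2 ler_peMr// mulr_ge0.
  rewrite expRN ler_pdivrMr ?expR_gt0// mul1r.
  by have := expR_ge1Dx (2 * K); lra.
have Gc : continuous G.
  apply: continuous_big => [|i _]; first exact: add_continuous.
  have lc : continuous (fun s : R => e * x i 0 + s * a i 0).
    move=> s; apply: cvgD; first exact: cvg_cst.
    by apply: cvgM; [exact: cvg_id|exact: cvg_cst].
  have ec : continuous (fun s : R => expR (e * x i 0 + s * a i 0)).
    by move=> s; apply: (continuous_comp (lc s)); exact: continuous_expR.
  by move=> s; apply: cvgM; [exact: cvg_cst|exact: ec].
have [s sI Gs] : exists2 s, s \in `[(- (2 * K)), (2 * K)] & G s = 1.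
  apply: IVT; [lra|exact: continuous_subspaceT|].
  by rewrite ge_min le_max Gup Gdown orbT.
have sK : `|s| <= 2 * K by move: sI; rewrite in_itv/= ler_norml.
pose u : 'cV[R]_I := \col_i (e * x i 0 + s * a i 0).
have sa i : `|s * a i 0| <= 2 * k * J%:R * e ^+ 2.
  have a0 : 0 <= a i 0 by rewrite (le_trans _ (a1 i)).
  rewrite normrM (ger0_norm a0) (_ : 2 * k * J%:R * e ^+ 2 = 2 * K * J%:R).
    exact: ler_pM.
  by rewrite /K; ring.
have uU i : `|u i 0| <= e * U.
  rewrite mxE (le_trans (ler_normD _ _))// /U mulrDr lerD//.
    by rewrite normrM (gtr0_norm e0) ler_wpM2l.
  rewrite (le_trans (sa i))// mulrC ler_wpM2r ?mulr_ge0//.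
  by rewrite expr2 ler_piMl.
pose q : 'cV[R]_I := \col_i (p i 0 * expR (u i 0)).
have qE i : q i 0 = p i 0 * expR (u i 0) by rewrite mxE.
exists q.
  split; first by move=> i; rewrite qE mulr_gt0 ?expR_gt0.
  split; first by rewrite -[RHS]Gs; apply: eq_bigr => i _; rewrite qE mxE.
  have [_ [_ [th pth]]] := pRM.
  exists (th + e *: tau + s *: const_mx 1); apply/colP => i.
  rewrite !mulmxDr -pth -!scalemxAr -/x -/a [LHS]mxE qE lnM ?posrE ?expR_gt0// expRK.
  by rewrite /u !mxE addrA.
move=> i; rewrite qE.
have -> : (p i 0 * expR (u i 0) - p i 0) / (e * p i 0) - x i 0 =
    (expR (u i 0) - 1 - u i 0 + s * a i 0) / e.
  by rewrite [u i 0]mxE; field; rewrite !gt_eqF.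
rewrite normrM normfV (gtr0_norm e0) ler_pdivrMr// (le_trans (ler_normD _ _))//.
rewrite -[leRHS]mulrA -expr2 [leRHS]mulrDl lerD// (le_trans (expR_taylor2 _))//.
rewrite -[u i 0 ^+ 2]real_normK ?num_real// [leRHS]mulrAC -exprMn.
apply: ler_pM; rewrite ?exprn_ge0 ?expR_ge0//.
  by rewrite [U * e]mulrC lerXn2r ?nnegrE ?mulr_ge0.
by rewrite ler_expR (le_trans (uU i))// ler_piMl.
Qed.

End MLE.

(** * Quadratic value of the divergences at the MLE *)

Section MLEQuadratic.
Variables (R : realType) (J I : nat) (A : 'M[R]_(J, I)) (p : 'cV[R]_I).
Hypotheses (A01 : zero_one_mx A) (A1 : col_has_one A).
Hypothesis pRM : RM A p.

Let p_gt0 i : 0 < p i 0. Proof. by case: pRM. Qed.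
Let p_sum1 : \sum_i p i 0 = 1. Proof. by case: pRM => _ []. Qed.

Local Notation S := (resid_form A p).

Lemma mulAp_neq0 : A *m p != 0.
Proof.
have [i _|no] := pickP (@predT 'I_I); last first.
  have : \sum_i p i 0 = 0 by rewrite big1// => i _; have := no i.
  by rewrite p_sum1 => /eqP; rewrite oner_eq0.
have [j Aj] := A1 i; apply/eqP => Ap0.
have := congr1 (fun B : 'cV_ _ => B j 0) Ap0; rewrite !mxE => /eqP.
rewrite psumr_eq0 => [/allP/(_ i (mem_index_enum _))|k _].
  by rewrite Aj mul1r gt_eqF.
by rewrite mulr_ge0 ?(ltW (p_gt0 k))//; case: (A01 j k) => ->.
Qed.

Let Ap := mulAp_neq0.

(** With q = p + e z both statistics are close to W z, the squared L^2(p)-length of (w - z)/p.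
    Minimality against a competitor whose displacement matches the tangent part of w bounds W z
    above by the form of w; Bessel's inequality bounds it below, since S z = O(e) makes the cross
    term negligible. *)
Lemma mle_quadratic_approx (M : R) : 0 <= M -> exists2 C : R, 0 <= C &
  exists2 e0 : R, 0 < e0 & forall (e : R) (w q : 'cV[R]_I), 0 < e <= e0 ->
    (forall i, `|w i 0| <= M) -> \sum_i w i 0 = 0 -> RM A q ->
    (forall q', RM A q' -> \sum_i kl_term (p i 0 + e * w i 0) (q i 0) <=
       \sum_i kl_term (p i 0 + e * w i 0) (q' i 0)) ->
  `|(e ^+ 2)^-1 * (\sum_i (p i 0 + e * w i 0 - q i 0) ^+ 2 / q i 0) - qform A p w| <= C * e /\
  `|(e ^+ 2)^-1 * (2 * \sum_i kl_term (p i 0 + e * w i 0) (q i 0)) - qform A p w| <= C * e.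
Proof.
move=> M0; have [m m0 mp] := ex_lower_bound p_gt0.
have m_half : m / 8 <= 1 / 2 * m by lra.
have one_plus (t : R) : `|t| <= 1 / 2 -> 0 < 1 + t.
  by rewrite ler_norml => /andP[? _]; lra.
have sqr_cross (a b c d : R) : - c <= a * b -> b ^+ 2 <= d ->
    (a - b) ^+ 2 <= a ^+ 2 + (2 * c + d) by move=> ? ?; nra.
have cross (a b c d k : R) : a + 2 * b + c <= d -> - k <= b -> 0 <= a -> c - 2 * k <= d.
  by move=> ? ? ?; lra.
(* The MLE minimises only the Bregman value; the Pearson value is tied to it through [Wz]. *)
have squeeze (Pq Bq Bq1 Wz Wz1 F c2 c3 c4 : R) :
    `|Pq - Wz| <= c2 -> `|Bq - Wz| <= c2 -> `|Bq1 - Wz1| <= c2 -> Bq <= Bq1 ->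
    Wz1 <= F + c3 -> F - c4 <= Wz -> 0 <= c2 -> 0 <= c3 -> 0 <= c4 ->
    `|Pq - F| <= c2 + c3 + c4 + 2 * c2 /\ `|Bq - F| <= c2 + c3 + c4 + 2 * c2.
  rewrite !ler_norml => /andP[? ?] /andP[? ?] /andP[? ?] ? ? ? ? ? ?.
  by split; apply/andP; split; lra.
pose Sm : R := \sum_i \sum_j `|S i j|.
have Sm0 : 0 <= Sm by do 2 (apply: sumr_ge0 => ? _).
pose X := M / m + Sm * M.
have X0 : 0 <= X by rewrite addr_ge0 ?mulr_ge0// invr_ge0 ltW.
have [C1 C10 [e1 e10 hcomp]] := ex_competitor A01 A1 pRM X0.
(* Bounds |z| by |w| + |w - z|: below, (w - z)^2 is at most B = 4 I M^2 / m, whence |w - z| <= B +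
   1. *)
pose M3 := M + (4 * (I%:R * (M ^+ 2 / m)) + 1).
have M30 : 0 <= M3.
  by rewrite !addr_ge0// mulr_ge0// mulr_ge0// divr_ge0 ?sqr_ge0// ltW.
pose M2 := M3 + (X + C1).
have M20 : 0 <= M2 by rewrite /M2; lra.
have [C2 C20 [e2 e20 happ]] := local_approx p_gt0 M20.
pose Q : R := \sum_i \sum_j
  `|(((resid_basis A p)^T *m invmx (resid_gram A p) *m ker_basis A) : 'M[R]_I) i j|.
have Q0 : 0 <= Q by do 2 (apply: sumr_ge0 => ? _).
(* The second-order remainder of ln(1 + e z / p), divided by e^2. *)
pose L := 4 * expR 1 * (M3 / m) ^+ 2 : R.
have L0 : 0 <= L by rewrite mulr_ge0 ?sqr_ge0// mulr_ge0// expR_ge0.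
pose C3 := C2 + (2 * (Sm * M) * C1 + C1 ^+ 2) + 2 * (I%:R * (M * (Q * L))).
have C3a : 0 <= 2 * (Sm * M) * C1 + C1 ^+ 2 by rewrite addr_ge0 ?sqr_ge0// !mulr_ge0.
have C3b : 0 <= 2 * (I%:R * (M * (Q * L))).
  by do 3 (apply: mulr_ge0 => //); apply: mulr_ge0.
have C30 : 0 <= C3 by rewrite /C3; lra.
exists (C3 + 2 * C2); first by lra.
pose e3 := m / (8 * (M3 + 1)).
have e30 : 0 < e3 by rewrite divr_gt0// mulr_gt0//; lra.
exists (Num.min 1 (Num.min e1 (Num.min e2 e3))); first by rewrite !lt_min ltr01 e10 e20.
move=> e w q /andP[e0]; rewrite !le_min => /and4P[el1 ee1 ee2 ee3] wM w0 qRM qmin.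
have e_ge0 := ltW e0; have e_neq0 : e != 0 by rewrite gt_eqF.
have [q_gt0 [q_sum1 [th qth]]] := qRM.
have [_ [_ [th0 pth0]]] := pRM.
have pm i : (p i 0)^-1 <= m^-1 by rewrite lef_pV2 ?posrE.
have minv : 0 <= m^-1 by rewrite invr_ge0 ltW.
have eM3 : e * M3 <= m / 8.
  move: ee3; rewrite /e3 ler_pdivlMr; last by rewrite mulr_gt0//; lra.
  nra.
have MM3 : M <= M3 by rewrite lerDl addr_ge0// mulr_ge0// mulr_ge0// mulr_ge0// sqr_ge0.
have M3M2 : M3 <= M2 by rewrite /M2; lra.
have eM : e * M <= m / 8 by rewrite (le_trans _ eM3)// ler_wpM2l.
pose u i := p i 0 + e * w i 0.
have u_gt0 i : 0 < u i.
  have : `|e * w i 0| <= m / 8 by rewrite normrM (gtr0_norm e0) (le_trans _ eM)// ler_wpM2l.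
  by rewrite ler_norml /u => /andP[h _]; have := mp i; lra.
have u_sum1 : \sum_i u i = 1 by rewrite big_split/= -mulr_sumr w0 mulr0 addr0.
have u_le1 i : u i <= 1.
  by rewrite -u_sum1 (bigD1 i)//= lerDl sumr_ge0// => j _; exact: ltW.
have q_le1 i : q i 0 <= 1 by exact: (p_le1 qRM).
pose z : 'cV[R]_I := \col_i ((q i 0 - p i 0) / e).
have qz i : q i 0 = p i 0 + e * z i 0 by rewrite mxE mulrC divfK// addrC subrK.
have z0 : \sum_i z i 0 = 0.
  under eq_bigr do rewrite mxE.
  by rewrite -mulr_suml sumrB q_sum1 p_sum1 subrr mul0r.
have zM3 i : `|z i 0| <= M3.
  have wzb : (w i 0 - z i 0) ^+ 2 <= 4 * (I%:R * (M ^+ 2 / m)).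
    (* The rate of the MLE: the divergence from u to q is at most that from u to p, which is O(e^2),
       and it dominates each squared difference. *)
    have h1 : (u i - q i 0) ^+ 2 / 4 <= \sum_j kl_term (u j) (q j 0).
      rewrite (bigD1 i)//= -[leLHS]addr0 lerD//.
        by apply: kl_term_ge; rewrite ?u_gt0 ?u_le1 ?q_gt0 ?q_le1.
      apply: sumr_ge0 => j _; apply: le_trans (kl_term_ge _ _).
      - by rewrite divr_ge0 ?sqr_ge0.
      - by rewrite u_gt0 u_le1.
      - by rewrite q_gt0 q_le1.
    have h2 : \sum_j kl_term (u j) (q j 0) <= e ^+ 2 * (I%:R * (M ^+ 2 / m)).
      apply: le_trans (qmin _ pRM) _.
      rewrite (_ : e ^+ 2 * (I%:R * (M ^+ 2 / m)) = \sum_(j < I) (e * M) ^+ 2 / m); last first.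
        by rewrite sumr_const card_ord -mulr_natl exprMn; ring.
      apply: ler_sum => j _; apply: le_trans (kl_term_le (u_gt0 j) (p_gt0 j)) _.
      rewrite /u addrAC subrr add0r; apply: ler_pM; rewrite ?sqr_ge0 ?invr_ge0 ?(ltW (p_gt0 j))//.
      rewrite -[leLHS]real_normK ?num_real// lerXn2r ?nnegrE ?mulr_ge0//.
      by rewrite normrM (gtr0_norm e0) ler_wpM2l.
    have := le_trans h1 h2; have -> : u i - q i 0 = e * (w i 0 - z i 0).
      by rewrite qz /u; ring.
    rewrite exprMn -mulrA ler_pM2l ?exprn_gt0//.
    by rewrite ler_pdivrMr// mulrC.
  have : `|w i 0 - z i 0| <= 4 * (I%:R * (M ^+ 2 / m)) + 1.
    move: wzb; rewrite -[(w i 0 - z i 0) ^+ 2]real_normK ?num_real//.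
    by have := normr_ge0 (w i 0 - z i 0); nra.
  have := ler_normB (w i 0) (w i 0 - z i 0); rewrite opprB addrC subrK => h1 h2.
  by rewrite (le_trans h1)// lerD.
have Sw i : `|(S *m w) i 0| <= Sm * M.
  rewrite mxE (le_trans (ler_norm_sum _ _ _))//.
  apply: (@le_trans _ _ ((\sum_j `|S i j|) * M)).
    by rewrite mulr_suml; apply: ler_sum => j _; rewrite normrM ler_wpM2l.
  rewrite ler_wpM2r// /Sm [leRHS](bigD1 i)//= lerDl.
  by apply: sumr_ge0 => ? _; apply: sumr_ge0.
have [tau taux] := resid_tangent p_gt0 p_sum1 Ap w0.
have xX i : `|(A^T *m tau) i 0| <= X.
  rewrite taux (le_trans (ler_normB _ _))// lerD// normrM ler_pM//.
  by rewrite gtr0_norm ?invr_gt0// pm.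
have sx : \sum_i p i 0 * (A^T *m tau) i 0 = 0.
  under eq_bigr => i _ do rewrite taux mulrBr mulrCA divff ?gt_eqF// mulr1.
  by rewrite sumrB w0 (mean_resid A p_gt0 p_sum1) subr0.
have e01 : 0 < e <= e1 by rewrite e0.
have [q1 q1RM q1x] := hcomp e tau e01 xX sx.
pose z1 : 'cV[R]_I := \col_i ((q1 i 0 - p i 0) / e).
have q1z i : q1 i 0 = p i 0 + e * z1 i 0 by rewrite mxE mulrC divfK// addrC subrK.
pose er i := z1 i 0 / p i 0 - (A^T *m tau) i 0.
have erb i : `|er i| <= C1 * e by have := q1x i; rewrite /er [z1 i 0]mxE invfM mulrA.
have z1M i : `|z1 i 0| <= X + C1.
  have -> : z1 i 0 = p i 0 * (er i + (A^T *m tau) i 0).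
    by rewrite /er subrK mulrC divfK// gt_eqF.
  rewrite normrM (gtr0_norm (p_gt0 i)) -[leRHS]mul1r; apply: ler_pM => //; first exact: ltW.
    exact: (p_le1 pRM).
  rewrite (le_trans (ler_normD _ _))// addrC lerD// (le_trans (erb i))//.
  by rewrite ler_piMr.
have wM2 i : `|w i 0| <= M2 by rewrite (le_trans (wM i))// (le_trans MM3).
have zM2 i : `|z i 0| <= M2 by rewrite (le_trans (zM3 i)).
have z1M2 i : `|z1 i 0| <= M2 by rewrite (le_trans (z1M i))// lerDr.
have e02 : 0 < e <= e2 by rewrite e0.
pose W (t : 'cV[R]_I) := \sum_i (w i 0 - t i 0) ^+ 2 / p i 0.
have [_ _ P2 B2] := happ e (fun i => w i 0) (fun i => z i 0) e02 wM2 zM2.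
have [_ _ _ B1] := happ e (fun i => w i 0) (fun i => z1 i 0) e02 wM2 z1M2.
have {}P2 : `|(e ^+ 2)^-1 * (\sum_i (u i - q i 0) ^+ 2 / q i 0) - W z| <= C2 * e.
  have -> : \sum_i (u i - q i 0) ^+ 2 / q i 0 = \sum_i (p i 0 + e * w i 0 -
      (p i 0 + e * z i 0)) ^+ 2 / (p i 0 + e * z i 0).
    by apply: eq_bigr => i _; rewrite -qz.
  exact: P2.
have {}B2 : `|(e ^+ 2)^-1 * (2 * \sum_i kl_term (u i) (q i 0)) - W z| <= C2 * e.
  have -> : \sum_i kl_term (u i) (q i 0) = \sum_i kl_term (p i 0 + e * w i 0)
      (p i 0 + e * z i 0) by apply: eq_bigr => i _; rewrite -qz.
  exact: B2.
have {}B1 : `|(e ^+ 2)^-1 * (2 * \sum_i kl_term (u i) (q1 i 0)) - W z1| <= C2 * e.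
  have -> : \sum_i kl_term (u i) (q1 i 0) = \sum_i kl_term (p i 0 + e * w i 0)
      (p i 0 + e * z1 i 0) by apply: eq_bigr => i _; rewrite -q1z.
  exact: B1.
(* The tangent parts cancel: (w - z1)/p is S w minus the O(e) error of the competitor. *)
have up : W z1 <= qform A p w + (2 * (Sm * M) * C1 + C1 ^+ 2) * e.
  have meanC (c : R) : c = \sum_i p i 0 * c by rewrite -mulr_suml p_sum1 mul1r.
  rewrite (qformE p_gt0 Ap) [X in _ + X]meanC -big_split/=.
  apply: ler_sum => i _.
  have -> : (w i 0 - z1 i 0) ^+ 2 / p i 0 = p i 0 * ((S *m w) i 0 - er i) ^+ 2.
    by rewrite /er taux; field; rewrite gt_eqF.
  rewrite -mulrDr ler_pM2l//.
  have SM0 : 0 <= Sm * M by rewrite mulr_ge0.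
  have h1 : `|(S *m w) i 0 * er i| <= Sm * M * (C1 * e) by rewrite normrM ler_pM.
  have h2 : er i ^+ 2 <= C1 ^+ 2 * e.
    rewrite -[leLHS]real_normK ?num_real//.
    apply: (@le_trans _ _ ((C1 * e) ^+ 2)); first by rewrite lerXn2r ?nnegrE ?mulr_ge0.
    by rewrite exprMn ler_wpM2l ?sqr_ge0// expr2 ler_piMl.
  move: h1; rewrite ler_norml => /andP[h1 _].
  have -> : (2 * (Sm * M) * C1 + C1 ^+ 2) * e = 2 * (Sm * M * (C1 * e)) + C1 ^+ 2 * e by ring.
  exact: sqr_cross.
have low : qform A p w - 2 * (I%:R * (M * (Q * L))) * e <= W z.
  (* Bessel's inequality for w - z, expanded around - z; the form of - z is nonnegative and only the
     cross term has to be bounded. *)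
  have qle := qform_le p_gt0 Ap (- z + w).
  have {}qle : qform A p (- z + w) <= W z.
    rewrite (le_trans qle)// le_eqVlt; apply/orP; left; apply/eqP.
    by apply: eq_bigr => i _; rewrite [(- z + w) i 0]mxE [(- z) i 0]mxE [- z i 0 + _]addrC.
  rewrite qformD in qle.
  have qz0 : 0 <= qform A p (- z).
    rewrite (qformE p_gt0 Ap) sumr_ge0// => i _.
    by rewrite mulr_ge0 ?sqr_ge0// ltW.
  have Sz i : `|(S *m - z) i 0| <= Q * (L * e).
    have Nz0 : \sum_i (- z) i 0 = 0.
      by under eq_bigr do rewrite mxE; rewrite sumrN z0 oppr0.
    (* Both p and q are in the model, so ln p - ln q is in the row space; it equals - ln(1 + e z /
       p), and dividing by e puts - z / p within O(e) of the row space. *)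
    have bd j : `|(- z) j 0 / p j 0 - (A^T *m (e^-1 *: (th0 - th))) j 0| <= L * e.
      have zp : `|z j 0 / p j 0| <= M3 / m.
        by rewrite normrM ler_pM// gtr0_norm ?invr_gt0// pm.
      pose rho := e * (z j 0 / p j 0).
      have rh : `|rho| <= 1 / 2.
        rewrite normrM (gtr0_norm e0) (le_trans (ler_wpM2l e_ge0 zp))// mulrA.
        by rewrite ler_pdivrMr// (le_trans eM3).
      have [lt _] := ln1D_taylor rh.
      have lnq : ln (q j 0) = (A^T *m th) j 0 by rewrite -qth mxE.
      have lnp : ln (p j 0) = (A^T *m th0) j 0 by rewrite -pth0 mxE.
      have rp := one_plus _ rh.
      have qrho : q j 0 = p j 0 * (1 + rho) by rewrite qz /rho; field; rewrite gt_eqF.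
      have -> : (- z) j 0 / p j 0 - (A^T *m (e^-1 *: (th0 - th))) j 0 =
          e^-1 * (ln (1 + rho) - rho).
        have scE (Y Y' : 'cV[R]_I) : (e^-1 *: (Y - Y')) j 0 = e^-1 * (Y j 0 - Y' j 0).
          by rewrite !mxE.
        rewrite -scalemxAr mulmxBr [(- z) j 0]mxE scE -lnp -lnq qrho lnM ?posrE// /rho.
        by field; rewrite e_neq0 gt_eqF.
      rewrite normrM gtr0_norm ?invr_gt0// ler_pdivrMl// (le_trans lt)//.
      have -> : e * (L * e) = 4 * expR 1 * (e * (M3 / m)) ^+ 2 by rewrite /L; ring.
      rewrite ler_wpM2l ?mulr_ge0 ?expR_ge0// -[leLHS]real_normK ?num_real//.
      rewrite lerXn2r ?nnegrE ?mulr_ge0//.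
      by rewrite normrM (gtr0_norm e0) ler_wpM2l.
    have := resid_form_tangent i Nz0 bd.
    move=> h; apply: (le_trans h); rewrite ler_wpM2r ?mulr_ge0//.
    rewrite /Q [leRHS](bigD1 i)//= lerDl.
    by apply: sumr_ge0 => ? _; apply: sumr_ge0.
  have : `|\sum_i w i 0 * (S *m - z) i 0| <= I%:R * (M * (Q * (L * e))).
    rewrite (le_trans (ler_norm_sum _ _ _))//.
    rewrite (_ : I%:R * _ = \sum_(i < I) (M * (Q * (L * e)))); last first.
      by rewrite sumr_const card_ord mulr_natl.
    by apply: ler_sum => i _; rewrite normrM ler_pM.
  rewrite ler_norml => /andP[h _].
  have -> : 2 * (I%:R * (M * (Q * L))) * e = 2 * (I%:R * (M * (Q * (L * e)))) by ring.
  exact: cross qle h qz0.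
have Bmin : (e ^+ 2)^-1 * (2 * \sum_i kl_term (u i) (q i 0)) <=
    (e ^+ 2)^-1 * (2 * \sum_i kl_term (u i) (q1 i 0)).
  by rewrite ler_pM2l ?invr_gt0 ?exprn_gt0// ler_pM2l//; exact: qmin.
have -> : (C3 + 2 * C2) * e = C2 * e + (2 * (Sm * M) * C1 + C1 ^+ 2) * e +
    2 * (I%:R * (M * (Q * L))) * e + 2 * (C2 * e) by rewrite /C3; ring.
by apply: squeeze P2 B2 B1 Bmin up low _ _ _; apply: mulr_ge0.
Qed.

End MLEQuadratic.

(** * Limit laws *)

Section Asymptotics.
Variables (R : realType) (J I : nat) (A : 'M[R]_(J, I)) (p : 'cV[R]_I).
Hypotheses (A01 : zero_one_mx A) (A1 : col_has_one A) (pRM : RM A p).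

Let p_gt0 i : 0 < p i 0. Proof. by case: pRM. Qed.
Let p_ge0 i : 0 <= p i 0. Proof. exact: ltW. Qed.
Let p_sum1 : \sum_i p i 0 = 1. Proof. by case: pRM => _ []. Qed.
Let Ap := mulAp_neq0 A01 A1 pRM.

Definition count_col (y : 'I_I -> nat) : 'cV[R]_I := \col_i (y i)%:R.

(** Since S p = 0, the form takes the same value at y and at y - N p; written at y it starts from 0
    and does not involve N, as the telescoping requires. *)
Definition limit_stat (N : nat) (y : 'I_I -> nat) : R := qform A p (count_col y) / N%:R.

Lemma qform_ge0 (w : 'cV[R]_I) : 0 <= qform A p w.
Proof. by rewrite (qformE p_gt0 Ap) sumr_ge0// => i _; rewrite mulr_ge0 ?sqr_ge0. Qed.

Lemma limit_stat_ge0 N y : 0 <= limit_stat N y.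
Proof. by rewrite divr_ge0 ?qform_ge0. Qed.

Lemma limit_stat_laplace (s : R) : 0 < s ->
  mult_exp p N (fun y => expR (- s * limit_stat N y)) @[N --> \oo] -->
  (1 + 2 * s) `^ (- ((dimKer A)%:R / 2)).
Proof.
apply: (@laplace_cvg _ _ p _ (fun y => qform A p (count_col y))
  (fun i y => (resid_form A p *m count_col y) i 0) (fun i => resid_form A p i i)) => //.
- by rewrite (_ : count_col _ = 0) ?/qform ?mulmx0 ?mxE//; apply/colP => i; rewrite !mxE.
- move=> i y; rewrite (_ : count_col _ = count_col y + delta_mx i 0); last first.
    by apply/colP => j; rewrite !mxE natrD eqxx andbT.
  rewrite qformD qform_delta; congr (_ + 2 * _ + _).
  rewrite (bigD1 i)//= [delta_mx _ _ _ _]mxE !eqxx mul1r big1 ?addr0// => j ji.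
  by rewrite [delta_mx _ _ _ _]mxE (negbTE ji) mul0r.
- by move=> y; exact: mean_resid.
- by move=> y; rewrite -qformE.
- by rewrite (resid_form_trace p_gt0 Ap); field.
Qed.

Definition good (M : R) (N : nat) (y : 'I_I -> nat) : Prop :=
  forall i, `|(y i)%:R - N%:R * p i 0| <= M * Num.sqrt N%:R.

Lemma mult_prob_bigcup N (B : 'I_I -> ('I_I -> nat) -> Prop) :
  mult_prob N p (fun y => exists i, B i y) <= \sum_i mult_prob N p (B i).
Proof.
under [leRHS]eq_bigr do rewrite mult_probE.
rewrite -mult_exp_sum mult_probE; apply: ler_mult_exp => // y _.
case: asboolP => [[i Bi]|_]; last by apply: sumr_ge0.
by rewrite (bigD1 i)//=; case: asboolP => // _; rewrite lerDl sumr_ge0.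
Qed.

Lemma mult_prob_good (e : R) : 0 < e -> exists2 M : R, 0 < M &
  \forall N \near \oo, mult_prob N p (fun y => ~ good M N y) <= e.
Proof.
(* Chebyshev over I cells gives I / M^2, at most e because e M >= I and M >= 1. *)
move=> e0; pose M : R := 1 + I%:R / e.
have Ie : 0 <= I%:R / e by rewrite divr_ge0// ltW.
have M1 : 1 <= M by rewrite /M; lra.
have M0 : 0 < M by lra.
exists M => //; near=> N.
have N0 : (0 < N)%N by near: N; exact: nbhs_infty_gt.
apply: (@le_trans _ _ (mult_prob N p (fun y => exists i,
    M * Num.sqrt N%:R < `|(y i)%:R - N%:R * p i 0|))).
  apply: mult_prob_le => // y _ /existsNP[i /negP]; rewrite -ltNge => h.
  by exists i.
apply: le_trans (mult_prob_bigcup _ _) _.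
apply: (@le_trans _ _ (\sum_(i < I) (M ^+ 2)^-1)).
  by apply: ler_sum => i _; exact: mult_chebyshev.
rewrite sumr_const card_ord -mulr_natl ler_pdivrMr ?exprn_gt0//.
apply: (@le_trans _ _ (e * M)).
  by rewrite /M mulrDr mulr1 mulrCA divff ?gt_eqF// mulr1 lerDr ltW.
by rewrite ler_pM2l// expr2 ler_peMr// ltW.
Unshelve. all: by end_near. Qed.

Lemma near_inv_sqrt (e : R) : 0 < e ->
  \forall N \near \oo, (0 < N)%N /\ (Num.sqrt N%:R : R)^-1 <= e.
Proof.
move=> e0; near=> N; split; first by near: N; exact: nbhs_infty_gt.
have N0 : (0 < N)%N by near: N; exact: nbhs_infty_gt.
rewrite -[leRHS]invrK lef_pV2 ?posrE ?invr_gt0 ?sqrtr_gt0 ?ltr0n//.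
have : e^-1 ^+ 2 <= N%:R by near: N; exact: nbhs_infty_ger.
by move/ler_wsqrtr; rewrite sqrtr_sqr ger0_norm// invr_ge0 ltW.
Unshelve. all: by end_near. Qed.

(** Both arguments have total 1, so the linear terms cancel and only the log-likelihood depends on
    q: maximising it is minimising the divergence. *)
Lemma sum_kl_term (N : nat) (y : 'I_I -> nat) (q : 'cV[R]_I) : (0 < N)%N ->
  (\sum_i y i = N)%N -> (forall i, (0 < y i)%N) -> RM A q ->
  \sum_i kl_term ((y i)%:R / N%:R) (q i 0) =
  \sum_i (y i)%:R / N%:R * ln ((y i)%:R / N%:R) - loglik y q / N%:R.
Proof.
move=> N0 yN y0 [q0 [q1 _]].
have NR : 0 < N%:R :> R by rewrite ltr0n.
have yq : \sum_i ((y i)%:R / N%:R - q i 0) = 0.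
  by rewrite sumrB -mulr_suml -natr_sum yN q1 divff ?subrr// gt_eqF.
rewrite /kl_term sumrB yq subr0 /loglik mulr_suml -sumrB; apply: eq_bigr => i _.
by rewrite ln_div ?posrE ?divr_gt0 ?ltr0n// mulrBr; congr (_ - _); ring.
Qed.

Lemma good_mle (M e : R) : 0 < M -> 0 < e -> \forall N \near \oo, forall y : 'I_I -> nat,
  (\sum_i y i = N)%N -> good M N y -> MLE_exists A y /\
  forall q, is_MLE A y q ->
    `|pearson (fun i => (y i)%:R) (fun i => (\sum_i y i)%:R * q i 0) - limit_stat N y| <= e /\
    `|bregman (fun i => (y i)%:R) (fun i => (\sum_i y i)%:R * q i 0) - limit_stat N y| <= e.
Proof.
move=> M0 e0.
have [C C0 [e1 e10 H]] := mle_quadratic_approx A01 A1 pRM (ltW M0).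
have [m m0 mp] := ex_lower_bound p_gt0.
(* Three demands on 1 / sqrt N: validity of the expansion, positivity of all counts, and an error
   below e. *)
pose e2 := Num.min e1 (Num.min (m / (2 * M)) (e / (C + 1))).
have e20 : 0 < e2 by rewrite !lt_min e10 !divr_gt0 ?mulr_gt0//; lra.
near=> N => y yN gy.
have [N0 Ne] : (0 < N)%N /\ (Num.sqrt N%:R : R)^-1 <= e2 by near: N; exact: near_inv_sqrt.
move: Ne; rewrite !le_min => /and3P[ee1 eem eeC].
pose d : R := (Num.sqrt N%:R)^-1; rewrite -/d in ee1 eem eeC.
have NR : 0 < N%:R :> R by rewrite ltr0n.
have sN : 0 < Num.sqrt N%:R :> R by rewrite sqrtr_gt0.
have d0 : 0 < d by rewrite invr_gt0.
have dN : d ^+ 2 = N%:R^-1 by rewrite exprVn sqr_sqrtr// ltW.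
have dsN : d * Num.sqrt N%:R = 1 by rewrite mulVf// gt_eqF.
pose w : 'cV[R]_I := \col_i (d * ((y i)%:R - N%:R * p i 0)).
have wM i : `|w i 0| <= M.
  rewrite mxE normrM (gtr0_norm d0) (le_trans (ler_wpM2l (ltW d0) (gy i)))//.
  by rewrite mulrCA dsN mulr1.
have uE i : p i 0 + d * w i 0 = (y i)%:R / N%:R.
  rewrite mxE mulrA -expr2 dN; field; exact: lt0r_neq0.
have w0 : \sum_i w i 0 = 0.
  under eq_bigr do rewrite mxE.
  by rewrite -mulr_sumr sumrB -natr_sum yN -mulr_sumr p_sum1 mulr1 subrr mulr0.
have y0 i : (0 < y i)%N.
  rewrite -(ltr0n R) -(pmulr_lgt0 _ (_ : 0 < N%:R^-1)) ?invr_gt0// -uE.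
  have : `|d * w i 0| <= m / 2.
    rewrite normrM (gtr0_norm d0) (le_trans (ler_wpM2l (ltW d0) (wM i)))//.
    by move: eem; rewrite ler_pdivlMr ?mulr_gt0//; lra.
  by rewrite ler_norml => /andP[h _]; have := mp i; lra.
have qw : qform A p w = limit_stat N y.
  have -> : w = d *: (count_col y + - N%:R *: p) by apply/colP => i; rewrite !mxE mulNr.
  have qZ (t : R) v : qform A p (t *: v) = t ^+ 2 * qform A p v.
    rewrite /qform (_ : (t *: v)^T = t *: v^T); last by apply/rowP => i; rewrite !mxE.
    by rewrite -!scalemxAl -scalemxAr scalerA mxE expr2.
  rewrite qZ dN mulrC /limit_stat; congr (_ / _); rewrite qformD qZ.
  rewrite [qform A p p](_ : _ = 0); last first.
    rewrite (qformE p_gt0 Ap) (resid_form_mulp A p_gt0 p_sum1) big1// => i _.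
    by rewrite mxE expr0n mulr0.
  rewrite mulr0 addr0 (_ : \sum_i _ = - N%:R * \sum_i p i 0 * (resid_form A p *m count_col y) i 0).
    by rewrite (mean_resid A p_gt0 p_sum1) !mulr0 addr0.
  by rewrite mulr_sumr; apply: eq_bigr => i _; rewrite [(_ *: p) i 0]mxE mulrA.
split; first exact: (mle_exists pRM y0).
move=> q [qRM qmax].
have d01 : 0 < d <= e1 by rewrite d0.
have qmin q' : RM A q' -> \sum_i kl_term (p i 0 + d * w i 0) (q i 0) <=
    \sum_i kl_term (p i 0 + d * w i 0) (q' i 0).
  move=> q'RM; under eq_bigr do rewrite uE; under [leRHS]eq_bigr do rewrite uE.
  rewrite !(sum_kl_term N0 yN y0)// lerD2l lerN2 ler_pM2r ?invr_gt0//.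
  exact: qmax.
have [] := H d w q d01 wM w0 qRM qmin.
have Ce : C * d <= e.
  move: eeC; rewrite ler_pdivlMr; last lra.
  by move=> h; rewrite (le_trans _ h)// mulrC ler_wpM2l ?(ltW d0)// lerDl.
rewrite qw dN invrK => h1 h2; have [q_gt0 _] := qRM.
have yE : (fun i => (y i)%:R) = fun i => N%:R * (p i 0 + d * w i 0) :> R.
  by apply/funext => i; rewrite uE mulrC divfK// gt_eqF.
have u0 i : 0 < p i 0 + d * w i 0 by rewrite uE divr_gt0// ltr0n.
rewrite yN yE; split.
  by rewrite pearson_scale// (le_trans h1).
by rewrite bregman_scale// (le_trans h2).
Unshelve. all: by end_near. Qed.

Lemma mult_prob_good_cvg (B : ('I_I -> nat) -> Prop) (x : R) :
  {for x, continuous (chi2_cdf (dimKer A) : R -> R)} ->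
  (forall M e : R, 0 < M -> 0 < e -> \forall N \near \oo, forall y : 'I_I -> nat,
    (\sum_i y i = N)%N -> good M N y ->
    (B y -> limit_stat N y <= x + e) /\ (limit_stat N y <= x - e -> B y)) ->
  mult_prob N p B @[N --> \oo] --> (chi2_cdf (dimKer A) x : R).
Proof.
move=> cx hB; apply: (mult_prob_cvg_chi2 p_gt0 p_sum1 limit_stat_ge0 limit_stat_laplace cx).
move=> e e0; have [M M0 nM] := mult_prob_good e0.
near=> N; apply: (@le_trans _ _ (mult_prob N p (fun y => ~ good M N y))); last by near: N.
apply: mult_prob_le => // y yN nh gy; apply: nh.
by move: y yN gy; near: N; exact: hB.
Unshelve. all: by end_near. Qed.

Lemma mult_prob_mle_cvg : mult_prob N p (MLE_exists A) @[N --> \oo] --> (1 : R).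
Proof.
apply/cvgrPdist_le => /= e e0; have [M M0 nM] := mult_prob_good e0.
near=> N; rewrite -[X in X - _](mult_probC p_sum1 N (MLE_exists A)) addrAC subrr add0r.
rewrite ger0_norm ?mult_prob_ge0//.
apply: (@le_trans _ _ (mult_prob N p (fun y => ~ good M N y))); last by near: N.
apply: mult_prob_le => // y yN nE gy; apply: nE.
suff [] : MLE_exists A y /\ forall q, is_MLE A y q ->
    `|pearson (fun i => (y i)%:R) (fun i => (\sum_i y i)%:R * q i 0) - limit_stat N y| <= e /\
    `|bregman (fun i => (y i)%:R) (fun i => (\sum_i y i)%:R * q i 0) - limit_stat N y| <= e by [].
by move: y yN gy; near: N; exact: good_mle.
Unshelve. all: by end_near. Qed.

(** Good counts admit an MLE. There the conditional event and the one for the augmented statistic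
    are squeezed by the same thresholds of [limit_stat], and the conditioning probability tends to
    1. *)
Lemma stat_cvg_chi2 (T T' : ('I_I -> nat) -> R) :
  (forall M e : R, 0 < M -> 0 < e -> \forall N \near \oo, forall y : 'I_I -> nat,
    (\sum_i y i = N)%N -> good M N y -> MLE_exists A y /\ `|T y - limit_stat N y| <= e) ->
  (forall y, MLE_exists A y -> T' y = T y) ->
  cvg_chi2 (fun N => cond_stat_cdf N p T (MLE_exists A)) (dimKer A) /\
  cvg_chi2 (fun N => stat_cdf N p T') (dimKer A).
Proof.
move=> hT TT'; split=> x cx.
  rewrite -[X in _ --> X]divr1 /cond_stat_cdf; apply: cvgM; last first.
    by apply: cvgV; [exact: oner_neq0|exact: mult_prob_mle_cvg].
  apply: mult_prob_good_cvg => // M e M0 e0; near=> N => y yN gy.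
  have [Ey] : MLE_exists A y /\ `|T y - limit_stat N y| <= e.
    by move: y yN gy; near: N; exact: hT.
  rewrite ler_norml => /andP[h1 h2]; split=> [[_ Tx]|Lx]; first lra.
  by split=> //; lra.
apply: mult_prob_good_cvg => // M e M0 e0; near=> N => y yN gy.
have [Ey] : MLE_exists A y /\ `|T y - limit_stat N y| <= e.
  by move: y yN gy; near: N; exact: hT.
by rewrite (TT' y Ey) ler_norml => /andP[h1 h2]; split=> ?; lra.
Unshelve. all: by end_near. Qed.

End Asymptotics.

Theorem theorem4p4 (R : realType) (J I : nat) (A : 'M[R]_(J, I))
    (p0 : 'cV[R]_I) (phat : ('I_I -> nat) -> 'cV[R]_I) :
  zero_one_mx A -> row_free A -> col_has_one A ->
  RM A p0 ->
  (forall y, MLE_exists A y -> is_MLE A y (phat y)) ->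
  let K := dimKer A in
  let Yr (y : 'I_I -> nat) : 'I_I -> R := fun i => (y i)%:R in
  let Nr (y : 'I_I -> nat) : R := (\sum_i y i)%:R in
  let phatN y : 'I_I -> R := fun i => Nr y * phat y i 0 in
  let ptilN y : 'I_I -> R := fun i => Nr y * aug_MLE A phat y i 0 in
  [/\ cvg_chi2 (fun N => cond_stat_cdf N p0
                   (fun y => pearson (Yr y) (phatN y)) (MLE_exists A)) K,
      cvg_chi2 (fun N => cond_stat_cdf N p0
                   (fun y => bregman (Yr y) (phatN y)) (MLE_exists A)) K,
      cvg_chi2 (fun N => stat_cdf N p0 (fun y => pearson (Yr y) (ptilN y))) K
    & cvg_chi2 (fun N => stat_cdf N p0 (fun y => bregman (Yr y) (ptilN y))) K].
Proof.
move=> A01 _ A1 pRM hphat K Yr Nr phatN ptilN.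
have augE y : MLE_exists A y -> ptilN y = phatN y.
  by move=> Ey; rewrite /ptilN /aug_MLE asboolT.
have close M e : 0 < M -> 0 < e -> \forall N \near \oo, forall y, (\sum_i y i = N)%N ->
    good p0 M N y -> MLE_exists A y /\
    (`|pearson (Yr y) (phatN y) - limit_stat A p0 N y| <= e /\
     `|bregman (Yr y) (phatN y) - limit_stat A p0 N y| <= e).
  move=> M0 e0; near=> N => y yN gy.
  have [Ey h] : MLE_exists A y /\ forall q, is_MLE A y q ->
    `|pearson (Yr y) (fun i => Nr y * q i 0) - limit_stat A p0 N y| <= e /\
    `|bregman (Yr y) (fun i => Nr y * q i 0) - limit_stat A p0 N y| <= e.
    by move: y yN gy; near: N; exact: good_mle.
  by split=> //; apply: h; exact: hphat.
have [P1 P2] : _ /\ _ := @stat_cvg_chi2 _ _ _ A p0 A01 A1 pRM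
  (fun y => pearson (Yr y) (phatN y)) (fun y => pearson (Yr y) (ptilN y))
  (fun M e M0 e0 => filterS (fun N h y yN gy =>
     let: conj Ey (conj hP _) := h y yN gy in conj Ey hP) (close M e M0 e0))
  (fun y Ey => congr1 _ (augE y Ey)).
have [B1 B2] : _ /\ _ := @stat_cvg_chi2 _ _ _ A p0 A01 A1 pRM
  (fun y => bregman (Yr y) (phatN y)) (fun y => bregman (Yr y) (ptilN y))
  (fun M e M0 e0 => filterS (fun N h y yN gy =>
     let: conj Ey (conj _ hB) := h y yN gy in conj Ey hB) (close M e M0 e0))
  (fun y Ey => congr1 _ (augE y Ey)).
by split.
Unshelve. all: by end_near. Qed.
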